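(* Let $f\in\mathcal{C}^{2r}(-b,b)$ ($b>0$, $r\ge1$ integer) with $f^{(2\ell-1)}(0)=0$ for $1\le\ell<r$ and $f^{(2r-1)}(0)\neq0$; write $f_k=f^{(k)}(0)/k!$. Let $x_1,\ldots,x_n\in\mathbb{R}$ with $r\le n$, and $\mathbf{K}_\varepsilon=[f(\varepsilon|x_i-x_j|)]_{i,j=1}^n$. Assume that for some $\varepsilon_0>0$, $\mathbf{K}_\varepsilon$ is positive semidefinite for $\varepsilon\in[0,\varepsilon_0]$, and that $\varepsilon\mapsto\mathbf{K}_\varepsilon$ is analytic near $0$. Let $\lambda_1(\varepsilon)\ge\cdots\ge\lambda_n(\varepsilon)$ be its eigenvalues for small $\varepsilon>0$, written $\lambda_s(\varepsilon)=\varepsilon^{2(s-1)}(\widetilde\lambda_s+\mathcal{O}(\varepsilon))$ for $s\le r$ and $\lambda_s(\varepsilon)=\varepsilon^{2r-1}(\widetilde\lambda_s+\mathcal{O}(\varepsilon))$ for $s>r$, and let $\mathbf{p}_1,\ldots,\mathbf{p}_n$ be the corresponding limiting eigenvectors. Then: 1. For $1\le s\le r$, $\widetilde\lambda_1\cdots\widetilde\lambda_s=\det(\mathbf{V}_{\le s-1}^\top\mathbf{V}_{\le s-1})\det(\mathbf{W}_{s-1})$. In particular, if $1<s\le r$ and $\det\mathbf{W}_{s-2}\neq0$, then \[\widetilde\lambda_s=\frac{\det(\mathbf{V}_{\le s-1}^\top\mathbf{V}_{\le s-1})}{\det(\mathbf{V}_{\le s-2}^\top\mathbf{V}_{\le s-2})}\cdot\frac{\det\mathbf{W}_{s-1}}{\det\mathbf{W}_{s-2}}.\]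 2. If the points $x_i$ are distinct and, for $1\le s\le r$, $\det\mathbf{W}_{s-1}\neq0$, then $\mathbf{p}_1,\ldots,\mathbf{p}_s$ are (up to sign) the first $s$ columns of the orthogonal factor $\mathbf{Q}_{\rm full}$ of a full QR factorization of $\mathbf{V}_{\le s-1}$. In particular, if $\det\mathbf{W}_{r-1}\neq0$, the last $n-r$ limiting eigenvectors $\mathbf{p}_{r+1},\ldots,\mathbf{p}_n$ span the column space of $\mathbf{Q}_\perp$. 3. If $\det\mathbf{W}_{r-1}\neq0$ and the points $x_i$ are distinct, then $\widetilde\lambda_{r+1},\ldots,\widetilde\lambda_n$ are the eigenvalues of $f_{2r-1}\mathbf{Q}_\perp^\top\mathbf{D}_{(2r-1)}\mathbf{Q}_\perp$. Here $\mathbf{Q}_\perp\in\mathbb{R}^{n\times(n-r)}$ consists of the last $n-r$ columns of the orthogonal factor of a full QR factorization of $\mathbf{V}_{\le r-1}$.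
   Context: Vandermonde: $\mathbf{V}_{\le k}=[x_i^{j}]_{1\le i\le n,\,0\le j\le k}$. Distance powers: $\mathbf{D}_{(k)}=[|x_i-x_j|^k]_{i,j=1}^n$. Wronskian: $\mathbf{W}_{k}$ is the $(k+1)\times(k+1)$ matrix with $(i,j)$ entry $\frac{K^{(i,j)}(0,0)}{i!j!}=(-1)^j\binom{i+j}{j}f_{i+j}$, $0\le i,j\le k$, where $K(x,y)=f(|x-y|)$. Full QR factorization of $\mathbf{V}\in\mathbb{R}^{n\times m}$: $\mathbf{V}=\mathbf{Q}_{\rm full}\begin{bmatrix}\mathbf{R}\\\mathbf{0}\end{bmatrix}$ with $\mathbf{Q}_{\rm full}$ orthogonal $n\times n$ and $\mathbf{R}$ upper triangular. Limiting eigenvectors: for a matrix function analytic in $\varepsilon$ and symmetric for real $\varepsilon$, eigenvalues $\lambda_k(\varepsilon)$ and orthogonal rank-one eigenprojectors $\mathbf{P}_k(\varepsilon)$ can be chosen analytic near $0$; the limiting eigenvector $\mathbf{p}_k$ is a unit vector with $\mathbf{P}_k(0)=\mathbf{p}_k\mathbf{p}_k^\top$ (up to sign). *)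

(* Defs.v *)
From HB Require Import structures.
From mathcomp Require Import all_boot all_order all_algebra.
From mathcomp Require Import all_classical all_reals all_analysis.
Set Implicit Arguments. Unset Strict Implicit. Unset Printing Implicit Defensive.
Import Order.TTheory GRing.Theory Num.Theory.
Import numFieldNormedType.Exports.
Local Open Scope ring_scope.

Section Defs.
Variable R : realType.

Definition fcoef (f : R -> R) (k : nat) : R := derive1n k f 0 / (k`!)%:R.

Definition Ck_on (k : nat) (f : R -> R) (b : R) : Prop :=
  (forall j, (j < k)%N -> forall y, -b < y < b -> derivable (derive1n j f) y 1)
  /\ (forall y, -b < y < b -> {for y, continuous (derive1n k f)}).

Definition Vdm n (x : 'I_n -> R) (k : nat) : 'M[R]_(n, k.+1) :=
  \matrix_(i, j) x i ^+ j.

Definition Dpow n (x : 'I_n -> R) (k : nat) : 'M[R]_n :=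
  \matrix_(i, j) `|x i - x j| ^+ k.

Definition Wr (f : R -> R) (k : nat) : 'M[R]_(k.+1) :=
  \matrix_(i, j) ((-1) ^+ j * ('C(i + j, j))%:R * fcoef f (i + j)).

Definition Keps n (f : R -> R) (x : 'I_n -> R) (e : R) : 'M[R]_n :=
  \matrix_(i, j) f (e * `|x i - x j|).

Definition psd n (M : 'M[R]_n) : Prop :=
  forall v : 'cV[R]_n, 0 <= (v^T *m M *m v) 0 0.

Definition analytic_near0 (g : R -> R) : Prop :=
  exists (a : nat -> R) (d : R), 0 < d /\
    forall e, `|e| < d -> (series (fun k => a k * e ^+ k) @ \oo --> g e)%classic.

Definition sorted_eigs n (M : 'M[R]_n) (l : 'I_n -> R) : Prop :=
  (forall i j : 'I_n, (i <= j)%N -> l j <= l i) /\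
  char_poly M = \prod_(i < n) ('X - (l i)%:P).

Definition eig_asymp (lam : R -> R) (m : nat) (lt : R) : Prop :=
  exists (C d : R), 0 < d /\
    forall e, 0 < e < d -> `|lam e - e ^+ m * lt| <= C * e ^+ m.+1.

(* exponent of the k-th (0-based) eigenvalue: 2k for k < r, 2r-1 otherwise *)
Definition eig_expo (r k : nat) : nat := if (k < r)%N then (2 * k)%N else (2 * r - 1)%N.

(* p are limiting eigenvectors of the analytic symmetric family K, corresponding
   (for small eps > 0) to the ordered eigenvalues lam: there is an analytic
   spectral decomposition K(e) = sum_k mu_k(e) P_k(e) near 0 with P_k(e) mutually
   orthogonal rank-one orthogonal projectors, mu_k = lam_k for small e > 0, and
   P_k(0) = p_k p_k^T with p_k a unit vector. *)
Definition limiting_eigvecs n (K : R -> 'M[R]_n) (lam : 'I_n -> R -> R)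
    (p : 'I_n -> 'cV[R]_n) : Prop :=
  exists (mu : 'I_n -> R -> R) (P : 'I_n -> R -> 'M[R]_n) (d : R),
    [/\ 0 < d,
     (forall k, analytic_near0 (mu k)) /\
     (forall k i j, analytic_near0 (fun e => P k e i j)),
     (forall e, `|e| < d ->
        K e = \sum_(k < n) mu k e *: P k e /\
        (forall k, [/\ (P k e)^T = P k e, P k e *m P k e = P k e,
                      \rank (P k e) = 1%N &
                      (forall l, k != l -> P k e *m P l e = 0)])),
     (forall k e, 0 < e < d -> mu k e = lam k e) &
     (forall k, (p k)^T *m p k = 1%:M /\ P k 0 = p k *m (p k)^T)].

Definition full_QR n m (V : 'M[R]_(n, m)) (Q : 'M[R]_n) : Prop :=
  Q *m Q^T = 1%:M /\
  exists Rm : 'M[R]_(n, m), (forall (i : 'I_n) (j : 'I_m), (j < i)%N -> Rm i j = 0)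
                            /\ V = Q *m Rm.

Lemma ordr_proof n r (j : 'I_(n - r)) : (r + j < n)%N.
Proof. by rewrite -ltn_subRL. Qed.

Definition ordr n r (j : 'I_(n - r)) : 'I_n := Ordinal (ordr_proof j).

Definition Qperp n r (Q : 'M[R]_n) : 'M[R]_(n, n - r) :=
  \matrix_(i, j) Q i (ordr j).

End Defs.

(* Main.v *)
(** With eps = t^4, the full QR factorization V_{<=k} = Q R (0-based k, k < r) and the Taylor
    expansion of f up to order 2k+1, the entries of Q^T K_eps Q are t^(d_i + d_j) L_ij(t), where
    d_i = 4i for i <= k and d_i = 4k+2 for i > k, and L(t) tends to a block diagonal matrix with
    blocks diag(R_ii) W_k diag(R_ii) and f_{2k+1} Q_perp^T D_(2k+1) Q_perp.  Comparing
    det(zI - Q^T K_eps Q), suitably rescaled, with prod_i (z - lambda_i) as t -> 0+ yields the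
    products of the limits of the scaled eigenvalues and, for k = r-1, the characteristic
    polynomial of the lower block.

    For the eigenvectors, positive semidefiniteness gives
    lambda_j q_i^T P_j q_i <= q_i^T K_eps q_i, whose right-hand side is of smaller order than
    lambda_j when i > j; hence q_i^T p_j = 0, and orthonormality forces p_j = +- q_j. *)
Require Import Defs.
From HB Require Import structures.
From mathcomp Require Import all_boot all_order all_algebra.
From mathcomp Require Import all_classical all_reals all_analysis.
From mathcomp Require Import ring lra zify.
Import Order.TTheory GRing.Theory Num.Theory.
Import numFieldNormedType.Exports.
Local Open Scope ring_scope.
Set Implicit Arguments. Unset Strict Implicit. Unset Printing Implicit Defensive.

(** * Linear algebra *)

Lemma mulmx_tr_self_eq0 (R : realDomainType) n (u : 'cV[R]_n) : u^T *m u = 0 -> u = 0.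
Proof.
move=> /matrixP/(_ 0 0); rewrite !mxE => /eqP.
rewrite psumr_eq0 => [/allP u0|i _]; last by rewrite mxE -expr2 sqr_ge0.
apply/matrixP => i j; rewrite (ord1 j) [RHS]mxE.
by have := u0 i; rewrite mem_index_enum mxE mulf_eq0 orbb => /(_ isT)/eqP.
Qed.

(** The naturals below the size of the difference would be too many distinct roots for it.
    Characteristic polynomials can thus be compared through their values. *)
Lemma poly_ext_horner (R : numDomainType) (p q : {poly R}) :
  (forall w, p.[w] = q.[w]) -> p = q.
Proof.
move=> pq; apply/eqP; rewrite -subr_eq0; apply/negP => /negP pq0.
have : (size [seq i%:R : R | i <- iota 0 (size (p - q)%R)] < size (p - q)%R)%N.
  apply: max_poly_roots => //.
    by apply/allP => w _; rewrite rootE hornerD hornerN pq subrr.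
  by rewrite map_inj_uniq ?iota_uniq // => i j /eqP; rewrite eqr_nat => /eqP.
by rewrite size_map size_iota ltnn.
Qed.

Lemma horner_char_poly (R : comNzRingType) n (M : 'M[R]_n) z :
  (char_poly M).[z] = \det (z%:M - M).
Proof.
rewrite -[LHS](horner_evalE z) -det_map_mx; congr (\det _); apply/matrixP => i j.
by rewrite !mxE -[LHS]/((_ - _).[z]) hornerD hornerN hornerC hornerMn hornerX.
Qed.

(** A cast along [n = s + (n - s)] exposes [M] as a block matrix with vanishing upper right block.
    This serves to split the determinants of the block diagonal limits. *)
Lemma det_ordr_block (R : comPzRingType) n s (hs : (s <= n)%N) (M : 'M[R]_n) :
  (forall i j : 'I_n, (i < s)%N != (j < s)%N -> M i j = 0) ->
  \det M = \det (\matrix_(i < s, j < s) M (widen_ord hs i) (widen_ord hs j))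
           * \det (\matrix_(i < n - s, j < n - s) M (ordr i) (ordr j)).
Proof.
move=> M0.
have e : n = (s + (n - s))%N by rewrite subnKC.
have detC m (eq : n = m) : \det M = \det (castmx (eq, eq) M) by case: _ / eq.
rewrite (detC _ e) -[castmx _ _]submxK.
have -> : ursubmx (castmx (e, e) M) = 0.
  apply/matrixP => i j; rewrite !mxE castmxE M0 //=.
  by rewrite ltn_ord ltnNge leq_addr.
rewrite det_lblock; congr (_ * _); congr (\det _); apply/matrixP => i j;
  rewrite !mxE castmxE; congr (M _ _); exact/val_inj.
Qed.

(** The witness is the reflection I - 2 w w^T / |w|^2 with w = v - al e0, which exchanges [v] and
    [al *: e0], where [al] is the norm of [v]. If w = 0, the vector already has the required form
    and the identity serves. *)
Lemma exists_householder (R : rcfType) n (v : 'cV[R]_n.+1) :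
  exists H : 'M[R]_n.+1, H *m H^T = 1%:M /\ forall i, i != 0 -> (H *m v) i 0 = 0.
Proof.
have sc (a b : 'cV[R]_n.+1) : a^T *m b = ((a^T *m b) 0 0)%:M by rewrite -mx11_scalar.
set al := Num.sqrt ((v^T *m v) 0 0).
have vv0 (u : 'cV[R]_n.+1) : 0 <= (u^T *m u) 0 0.
  by rewrite mxE sumr_ge0 // => i _; rewrite !mxE -expr2 sqr_ge0.
have al2 : al ^+ 2 = (v^T *m v) 0 0 by rewrite sqr_sqrtr.
pose e0 : 'cV[R]_n.+1 := delta_mx 0 0.
have He0 i : i != 0 -> (al *: e0) i 0 = 0 by rewrite !mxE => /negPf -> /=; rewrite mulr0.
have [w wE] : exists w, w = v - al *: e0 by exists (v - al *: e0).
have [w0|w0] := eqVneq w 0.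
  exists 1%:M; split; first by rewrite trmx1 mulmx1.
  move=> i i0; rewrite mul1mx; have /eqP := w0; rewrite wE subr_eq0 => /eqP ->; exact: He0.
set c := (w^T *m w) 0 0.
have c0 : c != 0.
  by apply: contraNneq w0 => c0; apply/eqP/mulmx_tr_self_eq0; rewrite (sc w w) -/c c0 raddf0.
have e0v : (e0^T *m v) 0 0 = v 0 0.
  rewrite mxE (bigD1 0) //= big1 ?addr0; first by rewrite !mxE eqxx mul1r.
  by move=> i /negPf i0; rewrite !mxE i0 mul0r.
have ve0 : (v^T *m e0) 0 0 = v 0 0.
  rewrite mxE (bigD1 0) //= big1 ?addr0; first by rewrite !mxE eqxx mulr1.
  by move=> i /negPf i0; rewrite !mxE i0 mulr0.
have e0e0 : (e0^T *m e0) 0 0 = 1.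
  rewrite mxE (bigD1 0) //= big1 ?addr0; first by rewrite !mxE eqxx mulr1.
  by move=> i /negPf i0; rewrite !mxE i0 mulr0.
(* The equal norms of [v] and [al *: e0] give |w|^2 = 2 w^T v, which makes the reflection send [v]
   to [v - w]. *)
have cE : c = 2 * (w^T *m v) 0 0.
  rewrite /c wE [(v - _)^T]linearB /= [(al *: _)^T]linearZ /= !mulmxBl !mulmxBr -!scalemxAl -!scalemxAr.
  by rewrite (sc v v) -al2 (sc v e0) ve0 (sc e0 v) e0v (sc e0 e0) e0e0 !mxE /=; ring.
exists (1%:M - (2 / c) *: (w *m w^T)); split.
  rewrite linearB /= [(_ *: _)^T]linearZ /= trmx_mul trmxK trmx1 mulmxBl mul1mx mulmxBr mulmx1.
  rewrite -scalemxAl -scalemxAr scalerA mulmxA -[w *m w^T *m w]mulmxA (sc w w) -/c.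
  rewrite mul_mx_scalar -scalemxAl scalerA.
  have -> : 2 / c * (2 / c) * c = 2 / c + 2 / c by field.
  by rewrite scalerDl opprB addrK subrK.
move=> i i0; rewrite mulmxBl mul1mx -scalemxAl -mulmxA (sc w v) mul_mx_scalar scalerA.
have -> : 2 / c * (w^T *m v) 0 0 = 1 by rewrite mulrAC -cE divff.
by rewrite scale1r wE opprB addrC subrK He0.
Qed.

(** Induction on the number of columns: a reflection clears the first column below its top entry,
    the lower right block is factored recursively, and its orthogonal factor is bordered by 1. *)
Lemma exists_full_QR (R : realType) n m (V : 'M[R]_(n, m)) : exists Q, full_QR V Q.
Proof.
elim: m n V => [|m IH] [|n] V.
- by exists 1%:M; split; [rewrite trmx1 mulmx1|exists V; split; [case|rewrite mul1mx]].
- by exists 1%:M; split; [rewrite trmx1 mulmx1|exists V; split; [move=> ? []|rewrite mul1mx]].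
- by exists 1%:M; split; [rewrite trmx1 mulmx1|exists V; split; [case|rewrite mul1mx]].
have [H [HH Hv]] := exists_householder (col 0 V).
have HH' : H^T *m H = 1%:M by exact/mulmx1C.
pose W : 'M[R]_(1 + n, 1 + m) := H *m V.
have [Q [QQ [S [St SV]]]] := IH n (drsubmx W).
pose B : 'M[R]_(1 + n) := block_mx 1%:M 0 0 Q.
have BB : B *m B^T = 1%:M.
  by rewrite tr_block_mx mulmx_block !trmx0 !trmx1 !mul1mx !mul0mx !mulmx0 !addr0 !add0r QQ
    -scalar_mx_block.
exists (H^T *m B); split.
  by rewrite trmx_mul trmxK mulmxA -(mulmxA H^T) BB mulmx1.
exists (block_mx (ulsubmx W) (ursubmx W) 0 S : 'M[R]_(1 + n, 1 + m)); split.
  move=> i j ij; rewrite -[i](@splitK 1 n) -[j](@splitK 1 m).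
  move: ij; case: split_ordP => i' ->; case: split_ordP => j' -> /=.
  - by rewrite !ord1.
  - by rewrite !ord1.
  - by rewrite (@block_mxEdl _ 1 n 1 m) mxE.
  - by rewrite (@block_mxEdr _ 1 n 1 m) !add1n ltnS => /St.
have -> : V = H^T *m W by rewrite mulmxA HH' mul1mx.
rewrite -(mulmxA H^T); congr (_ *m _).
rewrite [RHS](@mulmx_block _ 1 n 1 n 1 m) !mul1mx !mul0mx !mulmx0 !addr0 !add0r -SV.
rewrite -[LHS]submxK; suff -> : dlsubmx W = 0 by [].
apply/matrixP => i j; rewrite !mxE (ord1 j).
have := Hv (rshift 1 i) isT; rewrite mxE => Hv'; rewrite -[RHS]Hv'.
apply: eq_bigr => k _; rewrite !mxE; congr (_ * V _ _); exact/val_inj.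
Qed.

Local Open Scope classical_set_scope.

(** * Limits at 0+ *)

Lemma cvg_sum (R : realType) (T I : Type) (F : set_system T) {FF : Filter F} (r : seq I)
    (P : pred I) (f : I -> T -> R) (a : I -> R) :
  (forall i, P i -> f i x @[x --> F] --> a i) ->
  \sum_(i <- r | P i) f i x @[x --> F] --> \sum_(i <- r | P i) a i.
Proof. by move=> fa; apply: cvg_big => //; exact: add_continuous. Qed.

Lemma cvg_prodr (R : realType) (T I : Type) (F : set_system T) {FF : Filter F} (r : seq I)
    (P : pred I) (f : I -> T -> R) (a : I -> R) :
  (forall i, P i -> f i x @[x --> F] --> a i) ->
  \prod_(i <- r | P i) f i x @[x --> F] --> \prod_(i <- r | P i) a i.
Proof. by move=> fa; apply: cvg_big => //; exact: mul_continuous. Qed.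

Lemma cvg_det (R : realType) (T : Type) (F : set_system T) {FF : Filter F} n
    (M : T -> 'M[R]_n) (M0 : 'M[R]_n) :
  (forall i j, M x i j @[x --> F] --> M0 i j) -> \det (M x) @[x --> F] --> \det M0.
Proof.
move=> MM; rewrite /determinant; apply: cvg_sum => s _; apply: cvgM; first exact: cvg_cst.
by apply: cvg_prodr => i _; exact: MM.
Qed.

Lemma cvg_mulmx (R : realType) (T : Type) (F : set_system T) {FF : Filter F} m n p
    (M : T -> 'M[R]_(m, n)) (M0 : 'M[R]_(m, n))
    (N : T -> 'M[R]_(n, p)) (N0 : 'M[R]_(n, p)) :
  (forall i j, M x i j @[x --> F] --> M0 i j) ->
  (forall i j, N x i j @[x --> F] --> N0 i j) ->
  forall i j, (M x *m N x) i j @[x --> F] --> (M0 *m N0) i j.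
Proof.
move=> MM NN i j; rewrite mxE; under eq_cvg do rewrite mxE.
by apply: cvg_sum => k _; apply: cvgM.
Qed.

(** The boolean form of the limit turns truncated exponents, which are 0 exactly when a comparison
    of degrees holds, into indicator factors. *)
Lemma cvg_expr_right0 (R : realType) m : t ^+ m @[t --> (0 : R)^'+] --> ((m == 0%N)%:R : R).
Proof.
apply: cvg_at_right_filter; rewrite -(expr0n R m); exact: exprn_continuous.
Qed.

(** Transfers limits in eps to limits in t along eps = t^4. *)
Lemma cvg_expr4_right0 (R : realType) : (t : R) ^+ 4 @[t --> 0^'+] --> 0^'+.
Proof.
move=> A [d /= d0 Ad]; exists (Num.min d 1) => /=; first by rewrite lt_min d0 ltr01.
move=> t; rewrite /= sub0r normrN => + t0; rewrite gtr0_norm // lt_min => /andP[td t1].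
apply: Ad => /=; last exact: exprn_gt0.
rewrite sub0r normrN gtr0_norm ?exprn_gt0 //; apply: (@le_lt_trans _ _ t) => //.
by rewrite exprS ger_pMr // exprn_ile1 // ltW.
Qed.

(** [analytic_near0] provides pointwise convergence of the power series. Convergence at one point
    [y > 0] bounds the terms there, and comparison with a geometric series gives |g(e) - a_0| <= 2 M
    e / y for [e < y / 2]. *)
Lemma analytic_near0_cvg_right (R : realType) (g : R -> R) :
  analytic_near0 g -> g e @[e --> 0^'+] --> g 0.
Proof.
move=> [a [d [d0 H]]].
have a0 : g 0 = a 0%N.
  have H0 := H 0; rewrite normr0 in H0.
  apply: (cvg_unique (@Rhausdorff R) (H0 d0)).
  apply: cvg_near_cst; exists 1%N => // n /= n1.
  rewrite /series /= -(prednK n1) big_nat_recl // expr0 mulr1 big1 ?addr0 // => i _.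
  by rewrite expr0n mulr0.
have [y [y0 yd]] : exists y, 0 < y /\ `|y| < d.
  by exists (d / 2); rewrite gtr0_norm ?divr_gt0 //; split; lra.
have [M0 [_ HM]] := cvg_series_bounded (cvgP _ (H y yd)).
pose M := `|M0| + 1.
have aM k : `|a k * y ^+ k| <= M.
  by apply: HM => //; rewrite /M (le_lt_trans (ler_norm _)) // ltrDl.
have M_gt0 : 0 < M by rewrite /M ltr_wpDl.
have M_ge0 := ltW M_gt0.
(* The terms past the constant one are bounded by M (e / y) 2^-i for i = 0, 1, ..., and 2 (1 - 2^-n)
   is the sum of the first n of the 2^-i. *)
have bnd e n : 0 < e < y / 2 ->
    `|series (fun k => a k * e ^+ k) n.+1 - a 0%N| <= M * (e / y) * 2 * (1 - 2^-1 ^+ n).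
  move=> /andP[e0 ey]; elim: n => [|n IH].
    by rewrite /series /= big_nat1 expr0 mulr1 subrr normr0 subrr mulr0.
  have q0 : 0 <= e / y by rewrite divr_ge0 ?ltW.
  have q1 : e / y <= 2^-1 by rewrite ler_pdivrMr // mulrC ltW.
  have T : `|a n.+1 * e ^+ n.+1| <= M * (e / y) * 2^-1 ^+ n.
    have -> : a n.+1 * e ^+ n.+1 = (a n.+1 * y ^+ n.+1) * (e / y) ^+ n.+1.
      by rewrite expr_div_n -mulrA [y ^+ _ * _]mulrC divfK // expf_neq0 // gt_eqF.
    rewrite normrM -[leRHS]mulrA; apply: ler_pM => //.
    rewrite exprS normrM !ger0_norm ?exprn_ge0 //.
    by apply: ler_wpM2l => //; apply: lerXn2r; rewrite ?nnegrE ?invr_ge0.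
  rewrite /series /= big_nat_recr //= addrAC; apply: le_trans (ler_normD _ _) _.
  apply: le_trans (lerD IH T) _; rewrite exprS; lra.
apply/cvgrPdist_le => eta eta0; near=> e.
have e0 : 0 < e by near: e; exact: nbhs_right_gt.
have ed : `|e| < d by rewrite gtr0_norm //; near: e; exact: nbhs_right_lt.
have L : `|series (fun k => a k * e ^+ k) n.+1 - a 0%N| @[n --> \oo] --> `|g e - a 0%N|.
  apply: cvg_norm; apply: cvgB; last exact: cvg_cst.
  by have := H e ed; rewrite -(cvg_shiftS (series _)).
rewrite distrC a0; apply: (@le_trans _ _ (M * (e / y) * 2)).
  apply: (ler_cvg_to L (cvg_cst _)); near=> n.
  apply: le_trans (bnd e n _) _.
    by apply/andP; split => //; near: e; apply: nbhs_right_lt; rewrite divr_gt0.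
  by rewrite ger_pMr ?lerBlDr ?lerDl ?exprn_ge0 ?invr_ge0 ?mulr_gt0 ?invr_gt0.
have -> : M * (e / y) * 2 = e * (M * 2 / y) by field; rewrite gt_eqF.
have : e <= eta / (M * 2 / y + 1).
  by near: e; apply: nbhs_right_le; rewrite divr_gt0 // ltr_pwDr // !mulr_ge0 // invr_ge0 ltW.
have c0 : 0 <= M * 2 / y by rewrite !mulr_ge0 // invr_ge0 ltW.
rewrite ler_pdivlMr ?ltr_pwDr //; apply: le_trans.
by rewrite ler_pM2l // lerDl.
Unshelve. all: by end_near. Qed.

(** Induction on [N]: the derivative of the remainder [g] of [f] is the remainder [dg] of f', of one
    order less. As g(0) = 0, the mean value theorem gives g(t) = t dg(c) with 0 < c < t, and the
    induction hypothesis bounds dg(c). *)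
Lemma taylor_young_right (R : realType) N (f : R -> R) (b : R) : 0 < b ->
  (forall j, (j <= N)%N -> forall y, -b < y < b -> derivable (derive1n j f) y 1) ->
  (f t - \sum_(k < N.+1) fcoef f k * t ^+ k) / t ^+ N @[t --> 0^'+] --> (0 : R).
Proof.
move=> b0; elim: N f => [|N IH] f df.
  have : f t - f 0 @[t --> 0^'+] --> (f 0 - f 0).
    apply: cvgB; last exact: cvg_cst.
    apply: cvg_at_right_filter; apply: differentiable_continuous.
    by apply/derivable1_diffP; apply: (df 0%N) => //; rewrite oppr_lt0 b0.
  rewrite subrr; apply: cvg_trans; apply: near_eq_cvg; near=> t.
  by rewrite big_ord1 /fcoef /= !expr0 mulr1 !divr1.
have ds j : derive1n j f^`() = derive1n j.+1 f by rewrite /derive1n -iterSr.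
have {}IH := IH f^`() (fun j jN y => eq_ind_r (fun g => _ -> derivable g y 1)
   (df j.+1 jN y) (ds j)).
have fcS k : fcoef (derive1 f) k = k.+1%:R * fcoef f k.+1.
  by rewrite /fcoef ds factS natrM invfM mulrCA mulVKf // pnatr_eq0.
apply/cvgrPdist_le => eta eta0.
have /cvgrPdist_le/(_ _ eta0)[dl /= dl0 Hd] := IH.
near=> t; have t0 : 0 < t by near: t; exact: nbhs_right_gt.
have tb : t < b by near: t; exact: nbhs_right_lt.
have td : t < dl by near: t; exact: nbhs_right_lt.
pose g u : R := f u - \sum_(k < N.+2) fcoef f k * u ^+ k.
pose dg u : R := derive1 f u - \sum_(k < N.+1) fcoef (derive1 f) k * u ^+ k.
have Dg u : -b < u < b -> is_derive u 1 g (dg u).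
  move=> ub.
  have Df : is_derive u 1 f (derive1 f u).
    by rewrite derive1E; apply: derivableP; exact: (df 0%N).
  have -> : g = f - \sum_(k < N.+2) (fcoef f k *: (id ^+ k : R -> R)).
    by apply/funext => v; rewrite /g -[RHS]/(f v - (\sum_(k < N.+2) _) v) fct_sumE;
      congr (_ - _); apply: eq_bigr => k _; rewrite -[RHS]/(fcoef f k * (id ^+ k : R -> R) v) exprfctE.
  apply: (is_deriveB Df).
  have D := @is_derive_sum R R R N.+2 (fun k => fcoef f k *: (id ^+ k : R -> R)) u 1 _
    (fun k => is_deriveZ (fcoef f k) (@is_deriveX _ _ _ k _ _ _ (is_derive_id u 1))).
  apply: (is_derive_eq D).
  rewrite big_ord_recl /= mul0r scale0r scaler0 add0r; apply: eq_bigr => k _.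
  by rewrite fcS /= scaler1 [LHS]mulrA [fcoef _ _ * _]mulrC.
have g00 : g 0 = 0.
  rewrite /g big_ord_recl /= expr0 mulr1 {1}/fcoef /= divr1 big1 ?addr0 ?subrr // => k _.
  by rewrite expr0n mulr0.
have [c ct E] : exists2 c, c \in `]0, t[%R & g t - g 0 = dg c * (t - 0).
  apply: (@MVT R g dg 0 t) => //.
    by move=> u; rewrite in_itv /= => /andP[u0 ut]; apply: Dg; lra.
  apply: derivable_within_continuous => u; rewrite in_itv /= => /andP[u0 ut].
  by apply: @ex_derive; apply: Dg; lra.
move: E; rewrite g00 !subr0 => E; move: ct; rewrite in_itv /= => /andP[c0 ct].
have := Hd c; rewrite /= sub0r normrN gtr0_norm // => /(_ (lt_trans ct td) c0).
rewrite !sub0r !normrN normrM normfV (gtr0_norm (exprn_gt0 _ c0)) ler_pdivrMr ?exprn_gt0 //.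
rewrite -/(dg c) => Hc; rewrite -/(g t) E !normrM normfV (gtr0_norm t0) (gtr0_norm (exprn_gt0 _ t0)).
rewrite ler_pdivrMr ?exprn_gt0 // exprSr mulrA ler_pM2r //; apply: le_trans Hc _.
by rewrite ler_pM2l // lerXn2r // ?nnegrE; exact: ltW.
Unshelve. all: by end_near. Qed.

(** * Scaling limit of the kernel matrix *)

(* The matrix z I - K is multiplied on both sides by diag(t^(c - d_i)); the truncated
   subtractions c - d_i and d_i - c make every factor a nonnegative power of t. *)
Lemma char_poly_scaling_limit (R : realType) n (d : 'I_n -> nat) (c : nat)
    (K L : R -> 'M[R]_n) (L0 : 'M[R]_n) (l : 'I_n -> R -> R) (l0 : 'I_n -> R) :
  (\forall t \near 0^'+, (forall i j, K t i j = t ^+ (d i + d j) * L t i j)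
      /\ char_poly (K t) = \prod_(i < n) ('X - (t ^+ (2 * d i) * l i t)%:P)) ->
  (forall i j, L t i j @[t --> 0^'+] --> L0 i j) ->
  (forall i, l i t @[t --> 0^'+] --> l0 i) ->
  forall w, \det (\matrix_(i, j) (w * ((i == j) && (c <= d i)%N)%:R
                                  - ((d i <= c) && (d j <= c))%N%:R * L0 i j))
    = \prod_(i < n) (w * (c <= d i)%N%:R - (d i <= c)%N%:R * l0 i).
Proof.
move=> KL Lc lc w.
pose be t i : R := t ^+ (c - d i); pose ga t i : R := t ^+ (d i - c).
pose A t : 'M[R]_n := \matrix_(i, j) (w * be t i ^+ 2 *+ (i == j) - ga t i * ga t j * L t i j).
have bec i : be t i @[t --> 0^'+] --> ((c <= d i)%N%:R : R) by rewrite -subn_eq0; exact: cvg_expr_right0.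
have gac i : ga t i @[t --> 0^'+] --> ((d i <= c)%N%:R : R) by rewrite -subn_eq0; exact: cvg_expr_right0.
have sqb (b : bool) : (b%:R : R) * b%:R = b%:R by case: b; rewrite ?mulr1 ?mulr0.
(* Both sides are limits of det A(t): entrywise on the left, and on the right through the
   eigenvalues, which make the determinant an explicit product for small t > 0. *)
apply: (@cvg_unique _ (@Rhausdorff R) (\det (A t) @[t --> 0^'+])).
  apply: cvg_det => i j; rewrite !mxE; under eq_cvg do rewrite mxE.
  apply: cvgB.
    case: eqP => _ /=; last by rewrite mulr0; exact: cvg_cst.
    rewrite -sqb; under eq_cvg do rewrite mulr1n expr2.
    by apply: cvgM; [exact: cvg_cst|apply: cvgM].
  rewrite -mulnb natrM; by apply: cvgM => //; apply: cvgM.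
apply: cvg_trans (_ : \prod_(i < n) (w * (be t i * be t i) - (ga t i * ga t i) * l i t) @[t --> 0^'+]
    `=>` _); last first.
  apply: cvg_prodr => i _; rewrite -[(c <= _)%N%:R]sqb -[(_ <= c)%N%:R]sqb.
  apply: cvgB; apply: cvgM => //; first exact: cvg_cst.
    exact: cvgM.
  exact: cvgM.
apply: near_eq_cvg; near=> t.
have [KE cE] : (forall i j, K t i j = t ^+ (d i + d j) * L t i j)
      /\ char_poly (K t) = \prod_(i < n) ('X - (t ^+ (2 * d i) * l i t)%:P) by near: t.
have t0 : 0 < t by near: t; exact: nbhs_right_gt.
(* Both exponents equal max(c, d_i). *)
have bg i : be t i * t ^+ d i = t ^+ c * ga t i.
  by rewrite -!exprD; congr (_ ^+ _); lia.
pose B := diag_mx (\row_i be t i).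
(* The characteristic matrix is taken at z = w t^(2c), so that a factor t^(2c) comes out of every
   entry. *)
have BA : B *m ((w * (t ^+ c) ^+ 2)%:M - K t) *m B = (t ^+ c) ^+ 2 *: A t.
  apply/matrixP => i j; rewrite mul_mx_diag mul_diag_mx !mxE KE exprD.
  have -> : be t i * (w * t ^+ c ^+ 2 *+ (i == j) - t ^+ d i * t ^+ d j * L t i j) * be t j =
     (be t i * be t j * w * t ^+ c ^+ 2 *+ (i == j))
      - (be t i * t ^+ d i) * (be t j * t ^+ d j) * L t i j.
    by case: (i == j); rewrite ?mulr1n ?mulr0n; ring.
  rewrite !bg; case: eqP => [->|_]; rewrite ?mulr1n ?mulr0n; ring.
have tc0 : t ^+ c ^+ 2 != 0 by rewrite !expf_neq0 // gt_eqF.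
have := congr1 (fun M => \det M) BA; rewrite !det_mulmx -horner_char_poly cE detZ.
rewrite /B det_diag mulrAC -big_split horner_prod -big_split /=.
under eq_bigr => i _.
  rewrite !mxE hornerD hornerN hornerX hornerC.
  have -> : be t i * be t i * (w * t ^+ c ^+ 2 - t ^+ (2 * d i) * l i t)
     = t ^+ c ^+ 2 * (w * (be t i * be t i) - ga t i * ga t i * l i t).
    rewrite mulnC exprM.
    have -> : be t i * be t i * (w * t ^+ c ^+ 2 - t ^+ d i ^+ 2 * l i t) =
      be t i * be t i * w * t ^+ c ^+ 2 - (be t i * t ^+ d i) ^+ 2 * l i t by ring.
    by rewrite bg; ring.
  over.
by rewrite big_split /= prodr_const card_ord => /(mulfI (expf_neq0 _ tc0)) ->.
Unshelve. all: by end_near. Qed.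

(** * Expansion of the kernel matrix in the basis given by Q *)

Section KernelExpansion.
Variables (R : realType) (n : nat) (x : 'I_n -> R) (k : nat).

(** Signed differences, unlike [Dpow]: they expand by the binomial theorem, and up to order 2k the
    vanishing odd Taylor coefficients make the sign irrelevant. *)
Definition Spow (m : nat) : 'M[R]_n := \matrix_(i, j) (x i - x j) ^+ m.

Definition krem (f : R -> R) (e : R) : 'M[R]_n :=
  (e ^+ (2 * k).+1)^-1 *:
    (Keps f x e - \sum_(m < (2 * k).+1) (fcoef f m * e ^+ m) *: Spow m).

Lemma Keps_expansion f e : e != 0 ->
  Keps f x e = \sum_(m < (2 * k).+1) (fcoef f m * e ^+ m) *: Spow m
    + e ^+ (2 * k).+1 *: krem f e.
Proof.
by move=> e0; rewrite /krem scalerA divff ?expf_neq0 // scale1r addrC subrK.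
Qed.

Lemma fcoef_Spow f m i j :
  (forall l, (1 <= l <= k)%N -> derive1n (2 * l - 1) f 0 = 0) -> (m < (2 * k).+1)%N ->
  fcoef f m * (x i - x j) ^+ m = fcoef f m * `|x i - x j| ^+ m.
Proof.
move=> f0 mk; case om: (odd m); last first.
  by rewrite -normrX ger0_norm // exprn_even_ge0 // om.
have : derive1n (2 * (uphalf m) - 1) f 0 = 0 by apply: f0; lia.
have -> : (2 * uphalf m - 1 = m)%N by lia.
by rewrite /fcoef => ->; rewrite !mul0r.
Qed.

(** Entrywise this is the Taylor expansion of [f] to order 2k + 1 at [e * h], with h = |x_i - x_j|.
    The term of order 2k + 1 is not among those subtracted in [krem] and becomes the limit. *)
Lemma krem_cvg f b r : (k < r)%N -> 0 < b -> Ck_on (2 * r) f b ->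
  (forall l, (1 <= l < r)%N -> derive1n (2 * l - 1) f 0 = 0) ->
  forall i j, krem f e i j @[e --> 0^'+] -->
    (fcoef f (2 * k).+1 *: Dpow x (2 * k).+1) i j.
Proof.
move=> kr b0 [df _] f0 i j; rewrite !mxE.
have f0' l : (1 <= l <= k)%N -> derive1n (2 * l - 1) f 0 = 0.
  by move=> lk; apply: f0; lia.
set h := `|x i - x j|; set N := (2 * k).+1.
have kremE e : krem f e i j = (f (e * h) - \sum_(m < N) fcoef f m * (e * h) ^+ m) / e ^+ N.
  rewrite /krem !mxE mulrC summxE; congr ((_ - _) / _); apply: eq_bigr => m _.
  by rewrite !mxE mulrAC fcoef_Spow // exprMn -/h; ring.
under eq_cvg do rewrite kremE.
(* Coinciding points, in particular the diagonal, are treated apart, since h^N is divided out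
   below. *)
have [h0|h_neq0] := eqVneq h 0.
  rewrite h0 expr0n mulr0; apply: cvg_near_cst; near=> e.
  rewrite !mulr0 big_ord_recl /= expr0 mulr1 {1}/fcoef /= divr1 big1 ?addr0 ?subrr ?mul0r // => m _.
  by rewrite expr0n mulr0.
have h_gt0 : 0 < h by rewrite lt_neqAle eq_sym h_neq0 normr_ge0.
have T := @taylor_young_right R N f b b0.
have {}T := T (fun j jN y => df j (leq_ltn_trans jN _) y).
have {}T : (f t - \sum_(m < N.+1) fcoef f m * t ^+ m) / t ^+ N @[t --> 0^'+] --> (0 : R).
  by apply: T; rewrite /N; lia.
have eh : e * h @[e --> 0^'+] --> 0^'+.
  move=> A [d /= d0 Ad]; exists (d / h) => /=; first by rewrite divr_gt0.
  move=> e; rewrite /= sub0r normrN => + e0; rewrite gtr0_norm // ltr_pdivlMr // => ed.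
  by apply: Ad; rewrite /= ?mulr_gt0 // sub0r normrN gtr0_norm // mulr_gt0.
have {}T := cvg_comp _ _ eh T.
have C : (f (e * h) - \sum_(m < N.+1) fcoef f m * (e * h) ^+ m) / (e * h) ^+ N * h ^+ N
    + fcoef f N * h ^+ N @[e --> 0^'+] --> 0 * h ^+ N + fcoef f N * h ^+ N.
  by apply: cvgD; [apply: cvgM; [exact: T|exact: cvg_cst]|exact: cvg_cst].
rewrite mul0r add0r in C; apply: cvg_trans C; apply: near_eq_cvg; near=> e.
have e0 : 0 < e by near: e; exact: nbhs_right_gt.
rewrite /= big_ord_recr /= exprMn.
have eN : e ^+ N != 0 by rewrite expf_neq0 // gt_eqF.
have hN : h ^+ N != 0 by rewrite expf_neq0.
field.
by rewrite eN hN.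
Unshelve. all: by end_near. Qed.

Variable (Q : 'M[R]_n).
Hypothesis VQ : full_QR (Vdm x k) Q.

(** For a <= k this is the entry (i, a) of the triangular factor R; the expansion of [qSpow] also
    involves higher powers. *)
Definition qpow (a : nat) (i : 'I_n) : R := \sum_l Q l i * x l ^+ a.

Lemma qpow_eq0 a (i : 'I_n) : (a <= k)%N -> (a < i)%N -> qpow a i = 0.
Proof.
case: VQ => QQ [S [St VE]] ak ai.
have := congr1 (fun M => (Q^T *m M) i (Ordinal (ak : (a < k.+1)%N))) VE.
rewrite mulmxA (mulmx1C QQ) mul1mx St // mxE => <-; apply: eq_bigr => l _; by rewrite !mxE.
Qed.

Definition qSpow m := Q^T *m Spow m *m Q.

(** The binomial theorem separates the variables in (x_a - x_b)^m, so the double sum over a and b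
    factors. *)
Lemma qSpowE m i j : qSpow m i j =
  \sum_(c < m.+1) (-1) ^+ c * 'C(m, c)%:R * (qpow (m - c) i * qpow c j).
Proof.
rewrite /qSpow -mulmxA mxE.
transitivity (\sum_a \sum_b \sum_(c < m.+1)
   (-1) ^+ c * 'C(m, c)%:R * (Q a i * x a ^+ (m - c) * (Q b j * x b ^+ c))).
  apply: eq_bigr => a _; rewrite !mxE mulr_sumr; apply: eq_bigr => b _.
  rewrite !mxE exprBn mulr_suml mulr_sumr; apply: eq_bigr => c _.
  by rewrite -mulr_natr; ring.
under eq_bigr => a _ do rewrite exchange_big /=.
rewrite exchange_big /=; apply: eq_bigr => c _.
rewrite /qpow mulr_suml mulr_sumr; apply: eq_bigr => a _.
by rewrite mulr_sumr mulr_sumr.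
Qed.

(** In each term of [qSpowE] either m - c < min(i, k + 1) or c < min(j, k + 1), and the
    triangularity of R kills the corresponding factor. *)
Lemma qSpow_eq0 m (i j : 'I_n) : (m < minn i k.+1 + minn j k.+1)%N -> qSpow m i j = 0.
Proof.
move=> mij; rewrite qSpowE big1 // => c _.
have [ci|ci] := ltnP (m - c) (minn i k.+1).
  by rewrite qpow_eq0 ?mul0r ?mulr0 //; lia.
by have cb := ltn_ord c; rewrite [qpow c j]qpow_eq0 ?mulr0 //; lia.
Qed.

(** Only the term c = j survives: c > j annihilates the factor belonging to i, and c < j the one
    belonging to j. *)
Lemma qSpow_diag (i j : 'I_n) : (i <= k)%N -> (j <= k)%N ->
  qSpow (i + j) i j = (-1) ^+ j * 'C(i + j, j)%:R * (qpow i i * qpow j j).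
Proof.
move=> ik jk; have jij : (j < (i + j).+1)%N by lia.
rewrite qSpowE (bigD1 (Ordinal jij)) //= big1 ?addr0 ?addnK // => c cj.
have {}cj : (c : nat) != j by apply: contra_neq cj => cj; exact/val_inj.
have [lt|lt] := ltnP j c.
  by have cb := ltn_ord c; rewrite qpow_eq0 ?mul0r ?mulr0 //; lia.
by rewrite [qpow c j]qpow_eq0 ?mulr0 //; lia.
Qed.

(* With eps = t^4 the rows of Q^T K Q have sizes t^(4i) for i <= k and t^(4k+2) beyond,
   the fourth power avoiding half-integer exponents and leaving a gap at 4k+1. *)
Definition qdeg (i : nat) : nat := if (i <= k)%N then (4 * i)%N else (4 * k + 2)%N.

(** The truncation in [4 * m - (qdeg i + qdeg j)] is harmless: wherever it takes effect,
    [qSpow m i j] vanishes. *)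
Definition qKscaled (f : R -> R) (t : R) : 'M[R]_n := \matrix_(i, j)
  (\sum_(m < (2 * k).+1) fcoef f m * t ^+ (4 * m - (qdeg i + qdeg j)) * qSpow m i j
   + t ^+ (4 * (2 * k).+1 - (qdeg i + qdeg j)) * (Q^T *m krem f (t ^+ 4) *m Q) i j).

Definition qKlimit (f : R -> R) : 'M[R]_n := \matrix_(i, j)
  if (i <= k)%N && (j <= k)%N then Wr f k (inord i) (inord j) * (qpow i i * qpow j j)
  else if (k < i)%N && (k < j)%N
       then fcoef f (2 * k).+1 * (Q^T *m Dpow x (2 * k).+1 *m Q) i j
  else 0.

Lemma qKscaledE f t : 0 < t -> forall i j,
  (Q^T *m Keps f x (t ^+ 4) *m Q) i j = t ^+ (qdeg i + qdeg j) * qKscaled f t i j.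
Proof.
move=> t0 i j; rewrite (@Keps_expansion f (t ^+ 4)); last by rewrite expf_neq0 // gt_eqF.
rewrite mulmxDr mulmxDl mulmx_sumr mulmx_suml -scalemxAr -scalemxAl.
rewrite [qKscaled f t i j]mxE [LHS]mxE summxE [X in _ + X = _]mxE.
rewrite mulrDr mulr_sumr; congr (_ + _).
    apply: eq_bigr => m _; rewrite -scalemxAr -scalemxAl -/(qSpow m) mxE.
  have [H|H] := leqP (qdeg i + qdeg j) (4 * m).
    rewrite -{1}exprM -{1}(subnKC H) exprD; ring.
  (* Since [qdeg i <= 4 * minn i k.+1], the case 4m < d_i + d_j lies within the range of
     [qSpow_eq0]. *)
  rewrite qSpow_eq0 ?mulr0 //; by move: H; rewrite /qdeg; do 2 case: ifP => ?; lia.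
have H : (qdeg i + qdeg j <= 4 * (2 * k).+1)%N by rewrite /qdeg; do 2 case: ifP => ?; lia.
by rewrite -exprM -{1}(subnKC H) exprD mulrA.
Qed.

(** Only zero exponents survive. The upper block retains m = i + j alone. In the lower block every
    Taylor term vanishes by [qSpow_eq0], and the remainder has exponent 4(2k + 1) - 2(4k + 2) = 0.
    In the mixed blocks d_i + d_j is 2 modulo 4, so every nonvanishing term has a positive
    exponent. *)
Lemma qKscaled_cvg f b r : (k < r)%N -> 0 < b -> Ck_on (2 * r) f b ->
  (forall l, (1 <= l < r)%N -> derive1n (2 * l - 1) f 0 = 0) ->
  forall i j, qKscaled f t i j @[t --> 0^'+] --> qKlimit f i j.
Proof.
move=> kr b0 df f0 i j; under eq_cvg do rewrite mxE.
set D := (4 * (2 * k).+1 - (qdeg i + qdeg j))%N.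
have -> : qKlimit f i j = \sum_(m < (2 * k).+1)
    fcoef f m * (4 * m - (qdeg i + qdeg j) == 0)%N%:R * qSpow m i j
   + (D == 0)%N%:R * (Q^T *m (fcoef f (2 * k).+1 *: Dpow x (2 * k).+1) *m Q) i j.
  rewrite mxE /D /qdeg; case: (leqP i k) => ik; case: (leqP j k) => jk /=.
  - have ijk : (i + j < (2 * k).+1)%N by lia.
    rewrite [X in _ + X](_ : _ = 0) ?addr0; last first.
      by rewrite (_ : (_ == 0)%N = false) ?mul0r //; lia.
    rewrite (bigD1 (Ordinal ijk)) //= big1 ?addr0; last first.
      move=> m mij; have {}mij : (m : nat) != (i + j)%N.
        by apply: contra_neq mij => mij; exact/val_inj.
      have [mlt|mgt] := ltnP m (i + j).
        by rewrite qSpow_eq0 ?mulr0 //; lia.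
      by rewrite (_ : (_ == 0)%N = false) ?mulr0 ?mul0r //; lia.
    rewrite (_ : (_ == 0)%N = true) ?mulr1; last by lia.
    rewrite qSpow_diag // !mxE !inordK //; ring.
  - rewrite [X in _ + X](_ : _ = 0) ?addr0; last first.
      by rewrite (_ : (_ == 0)%N = false) ?mul0r //; lia.
    rewrite big1 // => m _; have [mlt|mgt] := ltnP m (i + k.+1).
      by rewrite qSpow_eq0 ?mulr0 //; lia.
    by rewrite (_ : (_ == 0)%N = false) ?mulr0 ?mul0r //; lia.
  - rewrite [X in _ + X](_ : _ = 0) ?addr0; last first.
      by rewrite (_ : (_ == 0)%N = false) ?mul0r //; lia.
    rewrite big1 // => m _; have [mlt|mgt] := ltnP m (j + k.+1).
      by rewrite qSpow_eq0 ?mulr0 //; lia.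
    by rewrite (_ : (_ == 0)%N = false) ?mulr0 ?mul0r //; lia.
  - rewrite big1 ?add0r => [|m _]; last first.
      by rewrite qSpow_eq0 ?mulr0 //; have := ltn_ord m; lia.
    rewrite (_ : (_ == 0)%N = true) ?mul1r; last by lia.
    by rewrite -scalemxAr -scalemxAl [RHS]mxE.
apply: cvgD.
  apply: cvg_sum => m _; apply: cvgM; last exact: cvg_cst.
  by apply: cvgM; [exact: cvg_cst|exact: cvg_expr_right0].
apply: cvgM; first exact: cvg_expr_right0.
apply: cvg_mulmx => [a c|a c]; last exact: cvg_cst.
apply: cvg_mulmx => [a' c'|a' c']; first exact: cvg_cst.
have T := cvg_comp _ _ (@cvg_expr4_right0 R) (krem_cvg kr b0 df f0 (i := a') (j := c')). exact: T.
Qed.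

End KernelExpansion.

(** * Scaled eigenvalues and the products of their limits *)

Lemma eig_asymp_cvg (R : realType) (la : R -> R) m l :
  eig_asymp la m l -> la e / e ^+ m @[e --> 0^'+] --> l.
Proof.
move=> [C [d [d0 H]]]; apply/cvgrPdist_le => eta eta0; near=> e.
have e0 : 0 < e by near: e; exact: nbhs_right_gt.
have em : 0 < e ^+ m by rewrite exprn_gt0.
have -> : l - la e / e ^+ m = - ((la e - e ^+ m * l) / e ^+ m) by field; rewrite gt_eqF.
rewrite normrN normrM normfV (gtr0_norm em) ler_pdivrMr //.
apply: le_trans (H e _) _; first by rewrite e0; near: e; exact: nbhs_right_lt.
rewrite exprS mulrA ler_pM2r //.
apply: (@le_trans _ _ ((`|C| + 1) * e)).
  by rewrite ler_pM2r // (le_trans (ler_norm _)) // lerDl.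
rewrite mulrC -ler_pdivlMr ?ltr_wpDl //.
by near: e; apply: nbhs_right_le; rewrite divr_gt0 // ltr_wpDl.
Unshelve. all: by end_near. Qed.

Lemma eig_asymp_scaled_cvg (R : realType) (la : R -> R) m l q :
  eig_asymp la m l -> (q <= 4 * m)%N ->
  la (t ^+ 4) / t ^+ q @[t --> 0^'+] --> l * (4 * m - q == 0)%N%:R.
Proof.
move=> al qm.
have T := cvg_comp _ _ (@cvg_expr4_right0 R) (eig_asymp_cvg al).
have C : la (t ^+ 4) / (t ^+ 4) ^+ m * t ^+ (4 * m - q) @[t --> 0^'+]
    --> l * (4 * m - q == 0)%N%:R.
  by apply: cvgM; [exact: T|exact: cvg_expr_right0].
apply: cvg_trans C; apply: near_eq_cvg; near=> t.
have t0 : t != 0 by rewrite gt_eqF //; near: t; exact: nbhs_right_gt.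
rewrite -exprM expfB_cond ?(negPf t0) //; field.
by rewrite !expf_neq0.
Unshelve. all: by end_near. Qed.

(** Equality holds for i <= k, and for every i when k = r - 1. For i > k with k < r - 1 the
    inequality is strict, so the corresponding scaled eigenvalue tends to 0. *)
Lemma qdeg_eig_expo r k i : (k < r)%N -> (2 * qdeg k i <= 4 * eig_expo r i)%N.
Proof. by move=> kr; rewrite /qdeg /eig_expo; do 2 case: ifP => ?; lia. Qed.

Section Spectrum.
Variables (R : realType) (f : R -> R) (b : R) (r n : nat) (x : 'I_n -> R).
Variables (lam : 'I_n -> R -> R) (lt : 'I_n -> R).
Hypotheses (b0 : 0 < b) (df : Ck_on (2 * r) f b).
Hypothesis f0 : forall l, (1 <= l < r)%N -> derive1n (2 * l - 1) f 0 = 0.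
Hypothesis lamE : exists d, 0 < d /\
  forall e, 0 < e < d -> sorted_eigs (Keps f x e) (fun k => lam k e).
Hypothesis lamlt : forall k, eig_asymp (lam k) (eig_expo r k) (lt k).

(** The degree [c] is left free: c = 4k + 1, in the gap of [qdeg], isolates the determinant of the
    upper block, while c = 4k + 2 puts the variable [w] on the lower block. *)
Lemma det_qKlimit k Q : (k < r)%N -> full_QR (Vdm x k) Q -> forall c w,
  \det (\matrix_(i, j) (w * ((i == j) && (c <= qdeg k i)%N)%:R
         - ((qdeg k i <= c) && (qdeg k j <= c))%N%:R * qKlimit x k Q f i j))
  = \prod_(i < n) (w * (c <= qdeg k i)%N%:R - (qdeg k i <= c)%N%:R
         * (lt i * (4 * eig_expo r i - 2 * qdeg k i == 0)%N%:R)).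
Proof.
move=> kr VQ c w.
apply: (@char_poly_scaling_limit R n (fun i => qdeg k i) c
  (fun t => Q^T *m Keps f x (t ^+ 4) *m Q) (qKscaled x k Q f) _
  (fun i t => lam i (t ^+ 4) / t ^+ (2 * qdeg k i))).
- case: lamE => d [d0 lamd].
  have td : \forall t \near (0 : R)^'+, t ^+ 4 < d := @cvg_expr4_right0 R _ (nbhs_right_lt d0).
  near=> t.
  have t0 : 0 < t by near: t; exact: nbhs_right_gt.
  split; first exact: qKscaledE.
  have [_ cE] : sorted_eigs (Keps f x (t ^+ 4)) (fun k => lam k (t ^+ 4)).
    by apply: lamd; rewrite exprn_gt0 //=; near: t.
  have [QQ _] := VQ; have QQ' := mulmx1C QQ.
  apply: poly_ext_horner => z; rewrite horner_char_poly.
  have -> : z%:M - Q^T *m Keps f x (t ^+ 4) *m Q = Q^T *m (z%:M - Keps f x (t ^+ 4)) *m Q.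
    by rewrite mulmxBr mulmxBl mul_mx_scalar -scalemxAl QQ' scalemx1.
  rewrite !det_mulmx mulrAC -det_mulmx QQ' det1 mul1r -horner_char_poly cE.
  congr (_.[z]); apply: eq_bigr => i _; congr (_ - _%:P).
  by rewrite mulrC divfK // expf_neq0 // gt_eqF.
- by move=> i j; apply: qKscaled_cvg kr b0 df f0 i j.
- by move=> i; apply: eig_asymp_scaled_cvg => //; exact: qdeg_eig_expo.
Unshelve. all: by end_near. Qed.

Lemma det_qKlimit_top k Q (kn : (k < n)%N) : 
  \det (\matrix_(i < k.+1, j < k.+1) qKlimit x k Q f (widen_ord kn i) (widen_ord kn j))
  = (\prod_(i < k.+1) qpow x Q i (widen_ord kn i)) ^+ 2 * \det (Wr f k).
Proof.
pose D := diag_mx (\row_(i < k.+1) qpow x Q i (widen_ord kn i)).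
have -> : \matrix_(i < k.+1, j < k.+1) qKlimit x k Q f (widen_ord kn i) (widen_ord kn j)
    = D *m Wr f k *m D.
  apply/matrixP => i j; rewrite mul_mx_diag mul_diag_mx mxE [in LHS]mxE /=.
  rewrite !leq_ord /= !inord_val [RHS]mxE [X in _ = X * _]mxE.
  by rewrite ![(\row__ _) _ _]mxE; ring.
rewrite !det_mulmx /D det_diag; under eq_bigr do rewrite mxE.
ring.
Qed.

(** V^T V = R^T R, and the rows of R past k are zero, so only its square triangular top block
    contributes. *)
Lemma det_gram_Vdm k Q (kn : (k < n)%N) : full_QR (Vdm x k) Q ->
  \det ((Vdm x k)^T *m Vdm x k) = (\prod_(i < k.+1) qpow x Q i (widen_ord kn i)) ^+ 2.
Proof.
move=> VQ; have [QQ _] := VQ.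
pose S := Q^T *m Vdm x k.
have SE i j : S i j = qpow x Q j i by rewrite !mxE; apply: eq_bigr => l _; rewrite !mxE.
pose T : 'M[R]_k.+1 := \matrix_(i, j) S (widen_ord kn i) j.
have -> : (Vdm x k)^T *m Vdm x k = T^T *m T.
  have -> : (Vdm x k)^T *m Vdm x k = S^T *m S.
    by rewrite trmx_mul trmxK mulmxA -(mulmxA _ Q) QQ mulmx1.
  apply/matrixP => i j; rewrite !mxE.
  rewrite (bigID (fun l : 'I_n => (l < k.+1)%N)) /= [X in _ + X]big1 ?addr0; last first.
    move=> l; rewrite -leqNgt => kl; rewrite mxE SE (qpow_eq0 VQ) ?mul0r //.
      by rewrite -ltnS.
    exact: leq_trans (ltn_ord i) kl.
  rewrite (@big_ord_narrow R 0 +%R k.+1 n _ kn) /=; apply: eq_bigr => l _; by rewrite !mxE.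
rewrite det_mulmx det_tr -expr2 -det_tr det_trig.
  by congr (_ ^+ 2); apply: eq_bigr => i _; rewrite mxE mxE SE.
by apply/is_trig_mxP => i j ij; rewrite mxE mxE SE (qpow_eq0 VQ) // -ltnS.
Qed.

Lemma prod_lt_eq k : (k < r)%N -> (k < n)%N ->
  \prod_(j < n | (j <= k)%N) lt j = \det ((Vdm x k)^T *m Vdm x k) * \det (Wr f k).
Proof.
move=> kr kn; have [Q VQ] := exists_full_QR (Vdm x k).
(* With c = 4k + 1 and w = -1 the matrix is minus the direct sum of the upper block and an identity;
   the product has factors -lt_i for i <= k and -1 beyond. The sign (-1)^n cancels. *)
have := det_qKlimit kr VQ (4 * k + 1) (-1).
pose M : 'M[R]_n := \matrix_(i, j) if (i <= k)%N && (j <= k)%N then qKlimit x k Q f i j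
   else (i == j)%:R.
have dle i : (qdeg k i <= 4 * k + 1)%N = (i <= k)%N by rewrite /qdeg; case: ifP => ?; lia.
have dge i : (4 * k + 1 <= qdeg k i)%N = (k < i)%N by rewrite /qdeg; case: ifP => ?; lia.
have -> : \matrix_(i, j) (-1 * ((i == j) && (4 * k + 1 <= qdeg k i)%N)%:R
         - ((qdeg k i <= 4 * k + 1) && (qdeg k j <= 4 * k + 1))%N%:R * qKlimit x k Q f i j)
    = -1 *: M.
  apply/matrixP => i j; rewrite [LHS]mxE [RHS]mxE [M i j]mxE !dle dge.
  case: (eqVneq i j) => [<-|ij]; last first.
    by case: ifP => _; rewrite ?mulr0 ?mul0r ?mul1r ?subr0 ?sub0r ?mulN1r.
  by rewrite andbb andTb; case: leqP => _; rewrite ?mulr0 ?mul0r ?mul1r ?mulr1 ?subr0 ?sub0r ?mulN1r.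
rewrite detZ (eq_bigr (fun i : 'I_n => -1 * (if (i <= k)%N then lt i else 1))); last first.
  move=> i _; rewrite dle dge; case: leqP => ik; last by rewrite mul0r subr0.
  rewrite (_ : (_ == 0)%N = true); first by rewrite mulr0 mul1r mulr1 sub0r mulN1r.
  by rewrite /qdeg /eig_expo ik (leq_ltn_trans ik kr); lia.
rewrite big_split /= prodr_const card_ord => /(mulfI (expf_neq0 _ _)) E.
rewrite big_mkcond /= -E ?oppr_eq0 ?oner_eq0 // (det_ordr_block kn); last first.
  move=> i j; rewrite !ltnS => ij; rewrite mxE ifF; last first.
    by move: ij; case: (i <= k)%N; case: (j <= k)%N.
  by case: (eqVneq i j) ij => [->|//]; rewrite eqxx.
rewrite (det_gram_Vdm kn VQ) -det_qKlimit_top -[RHS]mulr1; congr (_ * _).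
  congr (\det _); apply/matrixP => i j; rewrite mxE [M _ _]mxE [RHS]mxE /=.
  by rewrite !leq_ord.
rewrite -(det1 R (n - k.+1)); congr (\det _); apply/matrixP => i j.
rewrite mxE [M _ _]mxE [RHS]mxE ifF; first by congr ((_ : bool)%:R); rewrite -val_eqE /= eqn_add2l.
by rewrite /= leqNgt -ltnS ltnS leq_addr.
Qed.
End Spectrum.

(** * Ranks, orthogonality and limiting eigenvectors *)

(** A null vector of the Gram matrix is one of V as well, that is, a nonzero polynomial of degree at
    most [k] having every x_i as a root. *)
Lemma size_codom_gram_Vdm (R : realType) n (x : 'I_n -> R) k :
  \det ((Vdm x k)^T *m Vdm x k) = 0 -> (size (undup (codom x)) <= k)%N.
Proof.
move=> /eqP/det0P[v v0 vV].
have Vv : Vdm x k *m v^T = 0.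
  by apply: mulmx_tr_self_eq0; rewrite trmx_mul trmxK mulmxA -(mulmxA v) vV mul0mx.
have p0 : rVpoly v != 0 by apply: contra_neq v0 => E; rewrite -[v]rVpolyK E linear0.
rewrite -ltnS; apply: leq_trans (size_poly _ _ : size (rVpoly v) <= k.+1)%N.
apply: (max_poly_roots p0); last exact: undup_uniq.
apply/allP => y; rewrite mem_undup => /codomP[i ->]; rewrite rootE.
have := congr1 (fun M : 'cV[R]_n => M i 0) Vv; rewrite !mxE => E.
rewrite /rVpoly horner_poly -[X in _ == X]E; apply/eqP/eq_bigr => j _.
by rewrite insubT ?ltn_ord //= => h; rewrite !mxE mulrC; congr (_ * v _ _); exact/val_inj.
Qed.

Lemma gram_Vdm_neq0 (R : realType) n (x : 'I_n -> R) k :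
  injective x -> (k < n)%N -> \det ((Vdm x k)^T *m Vdm x k) != 0.
Proof.
move=> xi kn; apply/eqP => /size_codom_gram_Vdm.
rewrite undup_id; last by rewrite map_inj_uniq ?enum_uniq.
by rewrite size_codom card_ord leqNgt kn.
Qed.

(** Row i depends only on the value of x_i, so the matrix factors through the list of distinct
    values. *)
Lemma rank_Keps (R : realType) n (f : R -> R) (x : 'I_n -> R) e :
  (\rank (Keps f x e) <= size (undup (codom x)))%N.
Proof.
set s := undup (codom x).
have -> : Keps f x e = (\matrix_(i < n, a < size s) (nth 0 s a == x i)%:R) *m
    (\matrix_(a < size s, j < n) f (e * `|nth 0 s a - x j|)).
  apply/matrixP => i j; rewrite !mxE.
  have xs : x i \in s by rewrite mem_undup codom_f.
  have ix : (index (x i) s < size s)%N by rewrite index_mem.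
  rewrite (bigD1 (Ordinal ix)) //= big1 ?addr0 => [|a ax].
    by rewrite !mxE /= nth_index // eqxx mul1r.
  rewrite !mxE; case: eqP => [E|_]; last by rewrite mul0r.
  case/eqP: ax; apply/val_inj => /=.
  by rewrite -E index_uniq // undup_uniq.
exact: mulmx_max_rank.
Qed.

Lemma big_ordr_split (T : Type) (idx : T) (op : Monoid.com_law idx) n s (hs : (s <= n)%N)
    (F : 'I_n -> T) :
  \big[op/idx]_(i < n) F i
  = op (\big[op/idx]_(i < s) F (widen_ord hs i)) (\big[op/idx]_(j < n - s) F (ordr j)).
Proof.
have e : (s + (n - s))%N = n by rewrite subnKC.
rewrite (reindex (cast_ord e)); last first.
  by exists (cast_ord (esym e)) => i _; rewrite ?cast_ordK ?cast_ordKV.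
rewrite big_split_ord; congr (op _ _); apply: eq_bigr => i _; congr F; exact/val_inj.
Qed.

(** Strong induction on [j]: p_j has no component along q_i for i > j by hypothesis, nor for i < j,
    where q_i = +- p_i. Hence p_j = c q_j, and unit length gives c^2 = 1. *)
Lemma orthogonal_triangular_col (R : realDomainType) n (Q : 'M[R]_n) (p : 'I_n -> 'cV[R]_n) k :
  Q *m Q^T = 1%:M ->
  (forall i j, ((p i)^T *m p j) 0 0 = (i == j)%:R) ->
  (forall i j : 'I_n, (j <= k)%N -> (j < i)%N -> (Q^T *m p j) i 0 = 0) ->
  forall j : 'I_n, (j <= k)%N -> p j = col j Q \/ p j = - col j Q.
Proof.
move=> QQ pp pT j; have [m jm] := ubnP (j : nat); elim: m j jm => // m IH j jm jk.
have y0 (i : 'I_n) : i != j -> (Q^T *m p j) i 0 = 0.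
  case: (ltngtP i j) => [ij _|ij _|/val_inj ->]; last by rewrite eqxx.
    have E : (Q^T *m p j) i 0 = ((col i Q)^T *m p j) 0 0.
      by rewrite !mxE; apply: eq_bigr => l _; rewrite !mxE.
    have ij0 : ((p i)^T *m p j) 0 0 = 0 by rewrite pp -val_eqE ltn_eqF.
    case: (IH i _ _); [exact: leq_trans ij _|exact: leq_trans (ltnW ij) jk| |] => pi.
      by rewrite E -pi.
    by rewrite E -[col i Q]opprK -pi linearN mulNmx mxE ij0 oppr0.
  exact: pT.
have pE : p j = (Q^T *m p j) j 0 *: col j Q.
  rewrite -{1}[p j]mul1mx -QQ -mulmxA; apply/matrixP => i l; rewrite (ord1 l).
  rewrite mxE (bigD1 j) //= big1 ?addr0 => [|a aj]; last by rewrite y0 ?mulr0.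
  by rewrite [RHS]mxE [col _ _ _ _]mxE mulrC.
have cc : ((col j Q)^T *m col j Q) 0 0 = 1.
  transitivity ((Q^T *m Q) j j); last by rewrite (mulmx1C QQ) mxE eqxx.
  by rewrite !mxE; apply: eq_bigr => l _; rewrite !mxE.
move: ((Q^T *m p j) j 0) pE => c pE.
have := pp j j; rewrite eqxx pE [(c *: _)^T]linearZ /=.
rewrite -scalemxAl -scalemxAr scalerA mxE cc mulr1 -expr2 => /eqP.
by rewrite sqrf_eq1 => /orP[]/eqP ->; rewrite ?scale1r ?scaleN1r; [left|right].
Qed.

(** Expanded in the columns of [Q], the last columns of [P] have zero coefficients on the first r.
    The transposes are there because [submx] compares row spaces. *)
Lemma Qperp_sub (R : realType) n r (P Q : 'M[R]_n) : (r <= n)%N ->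
  Q *m Q^T = 1%:M ->
  (forall i j : 'I_n, (i < r)%N -> (r <= j)%N -> (Q^T *m P) i j = 0) ->
  ((Qperp r P)^T <= (Qperp r Q)^T)%MS.
Proof.
move=> rn QQ QP0.
pose B := \matrix_(j < n - r, l < n - r) (Q^T *m P) (ordr l) (ordr j).
suff -> : (Qperp r P)^T = B *m (Qperp r Q)^T by exact: submxMl.
apply/matrixP => j i; rewrite [RHS]mxE.
have -> : (Qperp r P)^T j i = (Q *m (Q^T *m P)) i (ordr j).
  by rewrite mulmxA QQ mul1mx !mxE.
rewrite mxE (big_ordr_split _ rn) /= big1 ?add0r => [|l _]; last first.
  by rewrite QP0 ?mulr0 //= leq_addr.
by apply: eq_bigr => l _; rewrite [(Qperp r Q)^T _ _]mxE [Qperp r Q _ _]mxE [B _ _]mxE mulrC.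
Qed.

(** Orthogonality is P_i(0) P_j(0) = 0 taken between p_i^T and p_j. *)
Lemma limiting_eigvecs_orthonormal (R : realType) n (K : R -> 'M[R]_n) lam p :
  limiting_eigvecs K lam p -> forall i j, ((p i)^T *m p j) 0 0 = (i == j)%:R.
Proof.
move=> [mu [P [d [d0 _ HP _ Hp]]]] i j.
have [-> |ij] := eqVneq i j; first by rewrite (Hp j).1 mxE.
have d00 : `|0 : R| < d by rewrite normr0.
have [_ /(_ i)[_ _ _ /(_ j ij)]] := HP 0 d00.
rewrite (Hp i).2 (Hp j).2 => /(congr1 (fun M => (p i)^T *m M *m p j)).
rewrite mulmx0 mul0mx !mulmxA (Hp i).1 mul1mx -mulmxA (Hp j).1 mulmx1.
by move=> ->; rewrite mxE.
Qed.

(** Extracts from the analytic decomposition the right continuity of the projectors at 0 and the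
    eigenvalue relations with K on either side. *)
Lemma limiting_eigvecs_right (R : realType) n (K : R -> 'M[R]_n) lam p :
  limiting_eigvecs K lam p -> exists P : 'I_n -> R -> 'M[R]_n,
    (forall k i j, P k e i j @[e --> 0^'+] --> (p k *m (p k)^T) i j) /\
    \forall e \near 0^'+, forall k, [/\ (P k e)^T = P k e, P k e *m P k e = P k e,
       K e *m P k e = lam k e *: P k e & P k e *m K e = lam k e *: P k e].
Proof.
move=> [mu [P [d [d0 [_ aP] HP ml Hp]]]]; exists P; split.
  by move=> k i j; rewrite -(Hp k).2; exact: analytic_near0_cvg_right (aP k i j).
near=> e => k.
have e0 : 0 < e by near: e; exact: nbhs_right_gt.
have ed : e < d by near: e; exact: nbhs_right_lt.
have ed' : `|e| < d by rewrite gtr0_norm.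
have [KE PE] := HP e ed'.
have [PT PP _ PO] := PE k.
split=> //; rewrite KE -ml ?e0 ?ed //.
  rewrite mulmx_suml (bigD1 k) //= big1 ?addr0 => [|l lk]; first by rewrite -scalemxAl PP.
  by have [_ _ _ /(_ k lk) E] := PE l; rewrite -scalemxAl E scaler0.
rewrite mulmx_sumr (bigD1 k) //= big1 ?addr0 => [|l lk]; first by rewrite -scalemxAr PP.
by rewrite -scalemxAr PO ?scaler0 // eq_sym.
Unshelve. all: by end_near. Qed.

(** K - la P = (1 - P) K (1 - P) is again positive semidefinite. *)
Lemma psd_deflate (R : realType) n (K P : 'M[R]_n) la : psd K ->
  P^T = P -> P *m P = P -> K *m P = la *: P -> P *m K = la *: P ->
  forall u : 'cV[R]_n, la * (u^T *m P *m u) 0 0 <= (u^T *m K *m u) 0 0.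
Proof.
move=> K0 PT PP KP PK u; have := K0 ((1%:M - P) *m u).
have -> : ((1%:M - P) *m u)^T *m K *m ((1%:M - P) *m u) =
    u^T *m K *m u - la *: (u^T *m P *m u).
  have PKP : (1%:M - P) *m K *m (1%:M - P) = K - la *: P.
    rewrite mulmxBl mul1mx PK mulmxBr mulmx1 mulmxBl KP -scalemxAl PP.
    by rewrite subrr subr0.
  rewrite trmx_mul [(1%:M - P)^T]linearB /= trmx1 PT !mulmxA -!(mulmxA u^T) PKP.
  by rewrite mulmxBl mulmxBr -scalemxAl -scalemxAr.
by rewrite mxE [X in _ + X]mxE [X in _ - X]mxE subr_ge0.
Qed.

Lemma psd_eig_ge0 (R : realType) n (K P : 'M[R]_n) la : psd K ->
  P^T = P -> P *m P = P -> K *m P = la *: P ->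
  forall u : 'cV[R]_n, 0 <= la * (u^T *m P *m u) 0 0.
Proof.
move=> K0 PT PP KP u; have := K0 (P *m u).
have -> : (P *m u)^T *m K *m (P *m u) = la *: (u^T *m P *m u).
  by rewrite trmx_mul PT !mulmxA -(mulmxA _ K P) KP -scalemxAr -scalemxAl -(mulmxA _ P P) PP.
by rewrite mxE.
Qed.

(** * Nonnegativity of the eigenvalue limits and orthogonality of the limiting eigenvectors *)

Section LimitingEigenvectors.
Variables (R : realType) (f : R -> R) (b : R) (r n : nat) (x : 'I_n -> R) (eps0 : R).
Variables (lam : 'I_n -> R -> R) (lt : 'I_n -> R) (p : 'I_n -> 'cV[R]_n).
Hypotheses (b0 : 0 < b) (df : Ck_on (2 * r) f b).
Hypothesis f0 : forall l, (1 <= l < r)%N -> derive1n (2 * l - 1) f 0 = 0.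
Hypotheses (e00 : 0 < eps0) (Kpsd : forall e, 0 <= e <= eps0 -> psd (Keps f x e)).
Hypothesis lamE : exists d, 0 < d /\
  forall e, 0 < e < d -> sorted_eigs (Keps f x e) (fun k => lam k e).
Hypothesis lamlt : forall k, eig_asymp (lam k) (eig_expo r k) (lt k).
Hypothesis lp : limiting_eigvecs (Keps f x) lam p.

Let pp := limiting_eigvecs_orthonormal lp.

(** Since p_k^T P_k(e) p_k tends to 1, it is positive for small e and can be divided out of
    [psd_eig_ge0] taken at p_k. *)
Lemma lam_ge0 k : \forall e \near 0^'+, 0 <= lam k e.
Proof.
have [P [Pp PE]] := limiting_eigvecs_right lp.
have C : ((p k)^T *m P k e *m p k) 0 0 @[e --> 0^'+] --> ((p k)^T *m (p k *m (p k)^T) *m p k) 0 0.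
  apply: cvg_mulmx => [i j|i j]; last exact: cvg_cst.
  by apply: cvg_mulmx => [i' j'|i' j']; [exact: cvg_cst|exact: Pp].
have l1 : ((p k)^T *m (p k *m (p k)^T) *m p k) 0 0 = 1.
  have pk : (p k)^T *m p k = 1%:M.
    by apply/matrixP => i j; rewrite !ord1 pp eqxx mxE.
  by rewrite mulmxA pk mul1mx pk mxE.
rewrite l1 in C; have Cpos : \forall e \near (0 : R)^'+, 0 < ((p k)^T *m P k e *m p k) 0 0.
  exact: cvgr_gt C _ ltr01.
near=> e.
have /(_ k)[PT PP KP _] : forall l, [/\ (P l e)^T = P l e, P l e *m P l e = P l e,
     Keps f x e *m P l e = lam l e *: P l e & P l e *m Keps f x e = lam l e *: P l e].
  by near: e.
have K0 : psd (Keps f x e).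
  by apply: Kpsd; apply/andP; split; [apply: ltW; near: e; exact: nbhs_right_gt
   |near: e; exact: nbhs_right_le].
have := psd_eig_ge0 K0 PT PP KP (p k); rewrite pmulr_lge0 //.
by near: e.
Unshelve. all: by end_near. Qed.

Lemma lt_ge0 k : 0 <= lt k.
Proof.
apply: (ler_cvg_to (cvg_cst 0) (eig_asymp_cvg (lamlt k))).
near=> e; have e0 : 0 <= e by apply: ltW; near: e; exact: nbhs_right_gt.
by rewrite divr_ge0 ?exprn_ge0 //; near: e; exact: lam_ge0.
Unshelve. all: by end_near. Qed.

(* If lt k were nonzero, lam_0, ..., lam_k would be positive for small e, so that the
   matrix [p_i^T P_i(e) p_j]_{i,j <= k}, which tends to I, would factor through K(e). *)
Lemma lt_eq0_of_rank (k : 'I_n) : (forall e, (\rank (Keps f x e) <= k)%N) -> lt k = 0.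
Proof.
move=> rk; apply/eqP/negP => /negP ltk0.
have [P [Pp PE]] := limiting_eigvecs_right lp.
have ltk_gt0 : 0 < lt k by rewrite lt_neqAle eq_sym ltk0 lt_ge0.
have lam_gt0 : \forall e \near (0 : R)^'+, 0 < lam k e / e ^+ eig_expo r k.
  exact: cvgr_gt (eig_asymp_cvg (lamlt k)) _ ltk_gt0.
pose w (i : 'I_k.+1) : 'I_n := widen_ord (ltn_ord k) i.
have pK i : (p i)^T *m p i = 1%:M by apply/matrixP => u v; rewrite !ord1 pp eqxx mxE.
pose M e : 'M[R]_k.+1 := \matrix_(i, j) ((p (w i))^T *m P (w i) e *m p (w j)) 0 0.
have Mc : \det (M e) @[e --> 0^'+] --> (1 : R).
  rewrite -(det1 R k.+1); apply: cvg_det => i j; under eq_cvg do rewrite mxE.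
  have -> : 1%:M i j = ((p (w i))^T *m (p (w i) *m (p (w i))^T) *m p (w j)) 0 0.
    by rewrite mulmxA pK mul1mx pp mxE -val_eqE.
  apply: cvg_mulmx => [u v|u v]; last exact: cvg_cst.
  by apply: cvg_mulmx => [u' v'|u' v']; [exact: cvg_cst|exact: Pp].
have : (1 : R) = 0.
  apply: (cvg_unique (@Rhausdorff R) Mc); apply: cvg_near_cst.
  case: lamE => d [d0 lamd]; near=> e.
  have e0 : 0 < e by near: e; exact: nbhs_right_gt.
  have [lamS _] : sorted_eigs (Keps f x e) (fun k => lam k e).
    by apply: lamd; rewrite e0; near: e; exact: nbhs_right_lt.
  have lk : 0 < lam k e.
    have : 0 < lam k e / e ^+ eig_expo r k by near: e.
    by rewrite pmulr_lgt0 // invr_gt0 exprn_gt0.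
  have PEe : forall l, [/\ (P l e)^T = P l e, P l e *m P l e = P l e,
     Keps f x e *m P l e = lam l e *: P l e & P l e *m Keps f x e = lam l e *: P l e].
    by near: e.
  (* P_i(e) is rewritten as lam_i^-1 P_i(e) K(e), which is legitimate because the ordering gives
     lam_i >= lam_k > 0 for i <= k. *)
  have ME : M e = (\matrix_(i, l) ((lam (w i) e)^-1 *: ((p (w i))^T *m P (w i) e)) 0 l)
      *m Keps f x e *m (\matrix_(l, j) p (w j) l 0).
    apply/matrixP => i j; have [_ _ _ PK] := PEe (w i).
    have li : lam (w i) e != 0.
      by rewrite gt_eqF // (lt_le_trans lk) // lamS // leq_ord.
    rewrite [LHS]mxE -[P (w i) e]scale1r -(mulVf li) -scalerA -PK.
    rewrite -scalemxAr mulmxA scalemxAl [LHS]mxE [RHS]mxE; apply: eq_bigr => l _.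
    rewrite [(\matrix_(_, _) _) l j]mxE; congr (_ * _).
    rewrite [LHS]mxE [RHS]mxE; apply: eq_bigr => m _; congr (_ * _).
    by rewrite [RHS]mxE.
  apply/eqP; apply: contraT => dM.
  have : (k.+1 <= \rank (Keps f x e))%N.
    rewrite -(mxrank_unit (A := M e)) ?unitmxE ?unitfE // ME.
    exact: leq_trans (mxrankM_maxl _ _) (mxrankM_maxr _ _).
  by rewrite leqNgt ltnS rk.
by move/eqP; rewrite oner_eq0.
Unshelve. all: by end_near. Qed.

Lemma limiting_eigvec_orth k Q (i j : 'I_n) : (k < r)%N -> full_QR (Vdm x k) Q ->
  (j <= k)%N -> (j < i)%N -> lt j != 0 -> (Q^T *m p j) i 0 = 0.
Proof.
move=> kr VQ jk ji ltj0.
have [P [Pp PE]] := limiting_eigvecs_right lp.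
have ltj : 0 < lt j by rewrite lt_neqAle eq_sym ltj0 lt_ge0.
set y := (Q^T *m p j) i 0.
pose a e := ((col i Q)^T *m P j e *m col i Q) 0 0.
have ac : a (t ^+ 4) @[t --> 0^'+] --> y ^+ 2.
  have yE : ((col i Q)^T *m (p j *m (p j)^T) *m col i Q) 0 0 = y ^+ 2.
    rewrite -[_ *m _ *m col i Q]mulmxA -[p j *m _ *m _]mulmxA mulmxA.
    have yE : (col i Q)^T *m p j = y%:M.
      apply/matrixP => u v; rewrite !ord1 [RHS]mxE /y !mxE.
      by apply: eq_bigr => l _; rewrite !mxE.
    by rewrite -[(p j)^T *m _]trmxK trmx_mul trmxK yE tr_scalar_mx -scalar_mxM mxE.
  have C : a e @[e --> 0^'+] --> y ^+ 2.
    rewrite -yE; apply: cvg_mulmx => [u v|u v]; last exact: cvg_cst.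
    by apply: cvg_mulmx => [u' v'|u' v']; [exact: cvg_cst|exact: Pp].
  exact: (cvg_comp _ _ (@cvg_expr4_right0 R) C).
(* This also covers i > k, where d_i = 4k + 2 > 4j. *)
have qij : (2 * qdeg k j < 2 * qdeg k i)%N.
  by rewrite /qdeg jk; case: ifP => ?; lia.
have lc := eig_asymp_scaled_cvg (lamlt j) (qdeg_eig_expo j kr).
have lc' : lam j (t ^+ 4) / t ^+ (2 * qdeg k j) * a (t ^+ 4) @[t --> 0^'+] --> lt j * y ^+ 2.
  apply: cvgM => //; move: lc; rewrite (_ : (_ == 0)%N = true) ?mulr1 //.
  by rewrite /qdeg /eig_expo jk (leq_ltn_trans jk kr); lia.
have rc : t ^+ (2 * qdeg k i - 2 * qdeg k j) * qKscaled x k Q f t i i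
    @[t --> 0^'+] --> (0 * qKlimit x k Q f i i).
  apply: cvgM; last exact: (qKscaled_cvg VQ kr b0 df f0).
  have := @cvg_expr_right0 R (2 * qdeg k i - 2 * qdeg k j).
  by rewrite (_ : (_ == 0)%N = false) //; lia.
have PE4 : \forall t \near (0 : R)^'+, forall l,
    [/\ (P l (t ^+ 4))^T = P l (t ^+ 4), P l (t ^+ 4) *m P l (t ^+ 4) = P l (t ^+ 4),
    Keps f x (t ^+ 4) *m P l (t ^+ 4) = lam l (t ^+ 4) *: P l (t ^+ 4)
    & P l (t ^+ 4) *m Keps f x (t ^+ 4) = lam l (t ^+ 4) *: P l (t ^+ 4)].
  exact: (@cvg_expr4_right0 R _ PE).
have te : \forall t \near (0 : R)^'+, t ^+ 4 <= eps0.
  exact: (@cvg_expr4_right0 R _ (nbhs_right_le e00)).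
(* The inequality of [psd_deflate] at q_i is divided by t^(2 d_j): the left side tends to lt_j y^2,
   while the right side keeps the factor t^(2 d_i - 2 d_j) and tends to 0. *)
have : lt j * y ^+ 2 <= 0 * qKlimit x k Q f i i.
  apply: (ler_cvg_to lc' rc); near=> t.
  have t0 : 0 < t by near: t; exact: nbhs_right_gt.
  have /(_ j)[PT PP KP PK] : forall l,
    [/\ (P l (t ^+ 4))^T = P l (t ^+ 4), P l (t ^+ 4) *m P l (t ^+ 4) = P l (t ^+ 4),
    Keps f x (t ^+ 4) *m P l (t ^+ 4) = lam l (t ^+ 4) *: P l (t ^+ 4)
    & P l (t ^+ 4) *m Keps f x (t ^+ 4) = lam l (t ^+ 4) *: P l (t ^+ 4)] by near: t.
  have K0 : psd (Keps f x (t ^+ 4)).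
    by apply: Kpsd; rewrite exprn_ge0 ?(ltW t0) //=; near: t.
  have := psd_deflate K0 PT PP KP PK (col i Q).
  have -> : ((col i Q)^T *m Keps f x (t ^+ 4) *m col i Q) 0 0
      = (Q^T *m Keps f x (t ^+ 4) *m Q) i i.
    rewrite [LHS]mxE [RHS]mxE; apply: eq_bigr => l _; rewrite [col _ _ _ _]mxE.
    by congr (_ * _); rewrite [LHS]mxE [RHS]mxE; apply: eq_bigr => m _; rewrite ![_^T _ _]mxE mxE.
  rewrite (qKscaledE VQ) // -/(a _) mulrAC ler_pdivrMr ?exprn_gt0 //.
  rewrite mulrAC -exprD subnK ?(ltnW qij) //.
  by rewrite addnn -mul2n.
rewrite mul0r pmulr_rle0 // => y2.
by apply/eqP; rewrite -sqrf_eq0 eq_le y2 sqr_ge0.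
Unshelve. all: by end_near. Qed.
End LimitingEigenvectors.

Local Close Scope classical_set_scope.

(** * The characteristic polynomial of the lower block *)

Lemma char_poly_Qperp (R : realType) (f : R -> R) (b : R) (k n : nat) (x : 'I_n -> R)
    (lam : 'I_n -> R -> R) (lt : 'I_n -> R) (Q : 'M[R]_n) :
  0 < b -> Ck_on (2 * k.+1) f b ->
  (forall l, (1 <= l < k.+1)%N -> derive1n (2 * l - 1) f 0 = 0) ->
  (exists d, 0 < d /\ forall e, 0 < e < d -> sorted_eigs (Keps f x e) (fun k => lam k e)) ->
  (forall i, eig_asymp (lam i) (eig_expo k.+1 i) (lt i)) ->
  (k < n)%N -> injective x -> \det (Wr f k) != 0 -> full_QR (Vdm x k) Q ->
  char_poly (fcoef f (2 * k).+1 *: ((Qperp k.+1 Q)^T *m Dpow x (2 * k).+1 *m Qperp k.+1 Q))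
     = \prod_(j < n - k.+1) ('X - (lt (ordr j))%:P).
Proof.
move=> b0 df f0 lamE lamlt kn xi W0 VQ.
have prodE := prod_lt_eq b0 df f0 lamE lamlt (ltnSn k) kn.
set G := \matrix_(i < k.+1, j < k.+1) qKlimit x k Q f (widen_ord kn i) (widen_ord kn j).
have GE : \det G = \prod_(i < k.+1) lt (widen_ord kn i).
  rewrite /G det_qKlimit_top -(det_gram_Vdm kn VQ) -prodE.
  exact: (@big_ord_narrow _ _ _ k.+1 n).
have G0 : \det G != 0.
  by rewrite /G det_qKlimit_top -(det_gram_Vdm kn VQ) mulf_neq0 // gram_Vdm_neq0.
apply: poly_ext_horner => w; rewrite horner_char_poly horner_prod.
(* For c = 4k + 2 and r = k + 1 no entry of the limit is dropped. Both sides split into an upper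
   factor, equal to the product of the -lt_i with i <= k, and the wanted value at [w]; the upper
   factor is nonzero and cancels. *)
have := det_qKlimit b0 df f0 lamE lamlt (ltnSn k) VQ (4 * k + 2) w.
have dle i : (qdeg k i <= 4 * k + 2)%N by rewrite /qdeg; case: ifP => ?; lia.
have dge i : (4 * k + 2 <= qdeg k i)%N = (k < i)%N by rewrite /qdeg; case: ifP => ?; lia.
set L := \matrix_(i, j) _; rewrite (big_ordr_split _ kn) /=.
have LE i j : L i j = w * ((i == j) && (k < i)%N)%:R - qKlimit x k Q f i j.
  by rewrite mxE !dle dge mul1r.
rewrite (det_ordr_block kn) => [|i j]; last first.
  rewrite !ltnS LE [qKlimit _ _ _ _ _ _]mxE => ij.
  rewrite ifF; last by move: ij; case: (i <= k)%N; case: (j <= k)%N.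
  rewrite ifF; last by move: ij; rewrite !ltnNge; case: (i <= k)%N; case: (j <= k)%N.
  by case: (eqVneq i j) ij => [->|_ _]; rewrite ?eqxx // mulr0 subr0.
have -> : \matrix_(i < k.+1, j < k.+1) L (widen_ord kn i) (widen_ord kn j) = -1 *: G.
  apply/matrixP => i j; rewrite [LHS]mxE LE [RHS]mxE [G i j]mxE /=.
  by rewrite [(k < i)%N]ltnNge leq_ord andbF mulr0 sub0r mulN1r.
have -> : \matrix_(i < n - k.+1, j < n - k.+1) L (ordr i) (ordr j) = w%:M -
     fcoef f (2 * k).+1 *: ((Qperp k.+1 Q)^T *m Dpow x (2 * k).+1 *m Qperp k.+1 Q).
  apply/matrixP => i j; rewrite [LHS]mxE LE [RHS]mxE [w%:M _ _]mxE [X in _ = _ + X]mxE /=.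
  have kr (l : 'I_(n - k.+1)) : (k < k.+1 + l)%N by rewrite leq_addr.
  rewrite kr andbT -val_eqE /= eqn_add2l val_eqE mulr_natr; congr (_ - _).
  rewrite [LHS]mxE /= !kr ![(_ <= k)%N]leqNgt !kr /= [RHS]mxE; congr (_ * _).
  rewrite [LHS]mxE [RHS]mxE; apply: eq_bigr => l _; rewrite [Qperp _ _ _ _]mxE; congr (_ * _).
  rewrite [LHS]mxE [RHS]mxE; apply: eq_bigr => m _; congr (_ * _).
  by rewrite !mxE.
rewrite detZ (eq_bigr (fun i => -1 * lt (widen_ord kn i))) => [|i _]; last first.
  rewrite dle dge /= ltnNge leq_ord mulr0 mul1r sub0r mulN1r.
  rewrite (_ : (_ == 0)%N = true) ?mulr1 //.
  by rewrite /qdeg /eig_expo leq_ord ltn_ord; lia.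
rewrite big_split /= prodr_const card_ord -GE => /(mulfI _) -> //; last first.
  by rewrite mulf_neq0 // expf_neq0 // oppr_eq0 oner_eq0.
apply: eq_bigr => j _; rewrite dle dge /= leq_addr mulr1 mul1r hornerD hornerN hornerX hornerC.
rewrite (_ : (_ == 0)%N = true) ?mulr1 //.
by rewrite /qdeg /eig_expo /= leqNgt leq_addr /= ltnNge leq_addr /=; lia.
Qed.

Theorem theorem4p5 (R : realType) (f : R -> R) (b : R) (r n : nat)
    (x : 'I_n -> R) (eps0 : R) (lam : 'I_n -> R -> R) (lt : 'I_n -> R)
    (p : 'I_n -> 'cV[R]_n) :
  0 < b -> (1 <= r)%N -> Ck_on (2 * r) f b ->
  (forall l, (1 <= l < r)%N -> derive1n (2 * l - 1) f 0 = 0) ->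
  derive1n (2 * r - 1) f 0 != 0 ->
  (r <= n)%N ->
  0 < eps0 -> (forall e, 0 <= e <= eps0 -> psd (Keps f x e)) ->
  (forall i j, analytic_near0 (fun e => Keps f x e i j)) ->
  (exists d, 0 < d /\ forall e, 0 < e < d -> sorted_eigs (Keps f x e) (fun k => lam k e)) ->
  (forall k, eig_asymp (lam k) (eig_expo r k) (lt k)) ->
  limiting_eigvecs (Keps f x) lam p ->
  (* 1. *)
  ((forall k : 'I_n, (k < r)%N ->
      \prod_(j < n | (j <= k)%N) lt j
        = \det ((Vdm x k)^T *m Vdm x k) * \det (Wr f k))
   /\ (forall k : 'I_n, (1 <= k < r)%N -> \det (Wr f k.-1) != 0 ->
      lt k = \det ((Vdm x k)^T *m Vdm x k) / \det ((Vdm x k.-1)^T *m Vdm x k.-1)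
             * (\det (Wr f k) / \det (Wr f k.-1))))
  /\
  (* 2. *)
  ((injective x ->
    forall k : 'I_n, (k < r)%N -> \det (Wr f k) != 0 ->
    forall Q : 'M[R]_n, full_QR (Vdm x k) Q ->
    forall j : 'I_n, (j <= k)%N -> p j = col j Q \/ p j = - col j Q)
   /\ (injective x -> \det (Wr f r.-1) != 0 ->
    forall Q : 'M[R]_n, full_QR (Vdm x r.-1) Q ->
    (\matrix_(j < n - r) (p (ordr j))^T == (Qperp r Q)^T)%MS))
  /\
  (* 3. *)
  (injective x -> \det (Wr f r.-1) != 0 ->
   forall Q : 'M[R]_n, full_QR (Vdm x r.-1) Q ->
   char_poly (fcoef f (2 * r - 1) *: ((Qperp r Q)^T *m Dpow x (2 * r - 1) *m Qperp r Q))
     = \prod_(j < n - r) ('X - (lt (ordr j))%:P)).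
Proof.
move=> b0 r0 df f0 _ rn e00 Kpsd _ lamE lamlt lp.
have pp := limiting_eigvecs_orthonormal lp.
have prodE k kr kn := prod_lt_eq b0 df f0 lamE lamlt (k := k) kr kn.
have part2 : injective x -> forall k, (k < n)%N -> (k < r)%N -> \det (Wr f k) != 0 ->
    forall Q : 'M[R]_n, full_QR (Vdm x k) Q ->
    forall j : 'I_n, (j <= k)%N -> p j = col j Q \/ p j = - col j Q.
  move=> xi k kn kr W0 Q VQ; apply: orthogonal_triangular_col VQ.1 pp _ => i j jk ji.
  apply: (limiting_eigvec_orth b0 df f0 e00 Kpsd lamlt lp kr VQ jk ji).
  (* The product formula makes every lt_j with j <= k nonzero. *)
  have : \prod_(j < n | (j <= k)%N) lt j != 0.
    by rewrite prodE // mulf_neq0 // gram_Vdm_neq0.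
  by move=> /prodf_neq0; apply.
split; [split|split; [split|]].
- by move=> k kr; exact: prodE.
- move=> k /andP[k0 kr] W0.
  have k1n : (k.-1 < n)%N by rewrite (leq_ltn_trans (leq_pred _)).
  have k1r : (k.-1 < r)%N by rewrite (leq_ltn_trans (leq_pred _)).
  (* The points may coincide here. If the Gram determinant vanishes, the right-hand side is 0 by the
     convention on inverses; there are then at most k - 1 distinct points, which bounds the rank of
     K and forces lt_k = 0. *)
  have [g0|g0] := eqVneq (\det ((Vdm x k.-1)^T *m Vdm x k.-1)) 0.
    rewrite g0 invr0 mulr0 mul0r.
    apply: (lt_eq0_of_rank e00 Kpsd lamE lamlt lp) => e.
    apply: leq_trans (rank_Keps _ _ _) (leq_trans (size_codom_gram_Vdm g0) (leq_pred _)).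
  have E := prodE k kr (ltn_ord k); have E1 := prodE k.-1 k1r k1n.
  rewrite (bigD1 k) //= in E.
  have E2 : \prod_(j < n | (j <= k)%N && (j != k)) lt j = \prod_(j < n | (j <= k.-1)%N) lt j.
    by apply: eq_bigl => j; rewrite -val_eqE /=; lia.
  rewrite E2 E1 in E.
  move/(congr1 (fun y => y / (\det ((Vdm x k.-1)^T *m Vdm x k.-1) * \det (Wr f k.-1)))): E.
  rewrite mulfK ?mulf_neq0 // => ->; field.
  by rewrite g0 W0.
- by move=> xi k kr; exact: part2.
- move=> xi W0 Q VQ.
  have r1r : (r.-1 < r)%N by rewrite prednK.
  have r1n : (r.-1 < n)%N by rewrite prednK.
  have P2 := part2 xi r.-1 r1n r1r W0 Q VQ.
  (* [P] and [Q] are both orthogonal and agree up to signs in their first r columns, so [Qperp_sub]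
     applies in both directions to the remaining columns. *)
  pose P : 'M[R]_n := \matrix_(i, j) p j i 0.
  have PP : P *m P^T = 1%:M.
    apply: mulmx1C; apply/matrixP => i j; rewrite [RHS]mxE -pp !mxE.
    by apply: eq_bigr => l _; rewrite !mxE.
  have -> : \matrix_(j < n - r) (p (ordr j))^T = (Qperp r P)^T.
    by apply/matrixP => i j; rewrite !mxE.
  have QP (i j : 'I_n) : (i < r)%N -> (r <= j)%N -> (Q^T *m P) i j = 0.
    move=> ir rj; have E (y : 'cV[R]_n) : y = col i Q -> (Q^T *m P) i j = (y^T *m p j) 0 0.
      by move=> ->; rewrite !mxE; apply: eq_bigr => l _; rewrite !mxE.
    have ij : ((p i)^T *m p j) 0 0 = 0.
      by rewrite pp -val_eqE ltn_eqF //; exact: leq_trans ir rj.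
    have ir1 : (i <= r.-1)%N by rewrite -ltnS prednK.
    case: (P2 i ir1) => pi; first by rewrite (E _ pi).
    rewrite (E (- p i)); last by rewrite pi opprK.
    by rewrite [(- p i)^T]linearN mulNmx mxE ij oppr0.
  have PQ (i j : 'I_n) : (i < r)%N -> (r <= j)%N -> (P^T *m Q) i j = 0.
    move=> ir rj; have [QQ _] := VQ.
    have E (y : 'cV[R]_n) : y = p i -> (P^T *m Q) i j = (y^T *m col j Q) 0 0.
      by move=> ->; rewrite !mxE; apply: eq_bigr => l _; rewrite !mxE.
    have ij : ((col i Q)^T *m col j Q) 0 0 = 0.
      transitivity ((Q^T *m Q) i j).
        by rewrite !mxE; apply: eq_bigr => l _; rewrite !mxE.
      by rewrite (mulmx1C QQ) mxE -val_eqE ltn_eqF //; exact: leq_trans ir rj.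
    have ir1 : (i <= r.-1)%N by rewrite -ltnS prednK.
    case: (P2 i ir1) => pi; first by rewrite (E _ (esym pi)).
    by rewrite (E _ (esym pi)) [(- col i Q)^T]linearN mulNmx mxE ij oppr0.
  by rewrite (Qperp_sub rn VQ.1 QP) (Qperp_sub rn PP PQ).
- move=> xi; case: r r0 df f0 rn lamlt {prodE part2} => // k _ df f0 kn lamlt /= W0 Q VQ.
  have -> : (2 * k.+1 - 1 = (2 * k).+1)%N by lia.
  exact: char_poly_Qperp b0 df f0 lamE lamlt kn xi W0 VQ.
Qed.
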